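(* Forest-Identification admits a kernel with $\mathcal{O}(k^3)$ vertices when parameterized by $k$.
   Context: All graphs are finite, simple and undirected. An identification of two distinct vertices $u,v$ replaces them with a new vertex adjacent to every vertex of $(N(u)\cup N(v))\setminus\{u,v\}$. Forest-Identification takes as input a graph $G$ and an integer $k\ge 0$ and asks whether $G$ can be transformed into a forest by at most $k$ identifications. A kernel is a polynomial-time algorithm that maps each instance $(G,k)$ to an equivalent instance $(G',k')$ of the same problem whose size (here: number of vertices of $G'$) and parameter $k'$ are bounded by a function of $k$. *)

(* Defs.v *)
From HB Require Import structures.
From mathcomp Require Import all_boot.

Set Implicit Arguments.
Unset Strict Implicit.
Unset Printing Implicit Defensive.

Record sgraph := SGraph {
  vertex :> finType;
  adj : rel vertex;
  adj_sym : symmetric adj;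
  adj_irrefl : irreflexive adj }.

(* [ucycle] allows the empty list, and in a simple graph an edge traversed
   back and forth is a [ucycle] of size 2; hence the size condition. *)
Definition forest (G : sgraph) : Prop :=
  ~ exists c : seq G, ucycle (@adj G) c /\ 2 < size c.

Section Identification.
Variables (G : sgraph) (u v : G).

(* [None] is the new vertex. *)
Definition identify_vertex : finType :=
  option {x : G | (x != u) && (x != v)}.

Definition identify_adj : rel identify_vertex := fun x y =>
  match x, y with
  | None, None => false
  | None, Some a | Some a, None => adj u (val a) || adj v (val a)
  | Some a, Some b => adj (val a) (val b)
  end.

Fact identify_adj_sym : symmetric identify_adj.
Proof. by move=> [a|] [b|] //=; rewrite adj_sym. Qed.

Fact identify_adj_irrefl : irreflexive identify_adj.
Proof. by move=> [a|] //=; rewrite adj_irrefl. Qed.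

Definition identify : sgraph := SGraph identify_adj_sym identify_adj_irrefl.

End Identification.

Inductive identifications : nat -> sgraph -> sgraph -> Prop :=
| identifications0 (G : sgraph) : identifications 0 G G
| identificationsS (j : nat) (G H : sgraph) (u v : G) :
    u != v -> identifications j (identify u v) H -> identifications j.+1 G H.

Definition forest_identification (G : sgraph) (k : nat) : Prop :=
  exists (j : nat) (H : sgraph), [/\ j <= k, identifications j G H & forest H].

(* The string 1^k 0 1^n 0 followed by the n x n adjacency matrix, row by row.
   The parameter is in unary, so that being polynomial in the length of the
   string means being polynomial in the size of the graph plus k. *)
Definition encode (G : sgraph) (k : nat) : seq bool :=
  nseq k true ++ false :: nseq #|G| true ++ false ::
  [seq adj x y | x <- enum G, y <- enum G].

(* Deterministic Turing machines with finitely many two-way infinite tapes. *)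

Inductive move := MoveL | MoveN | MoveR.

(* A cell is blank ([None]), an input/output bit ([Some (inl b)]), or an
   auxiliary work symbol ([Some (inr a)]). *)
Definition cell (A : Type) : Type := option (bool + A).

(* There are [tm_tapes.+1] tapes; tape [ord0] holds the input and the output. *)
Record turing_machine := TuringMachine {
  tm_tapes : nat;
  tm_work : finType;
  tm_state : finType;
  tm_start : tm_state;
  tm_halt : pred tm_state;
  tm_trans : tm_state -> {ffun 'I_tm_tapes.+1 -> cell tm_work} ->
    tm_state * {ffun 'I_tm_tapes.+1 -> cell tm_work * move} }.

(* The cells to the left of the head, nearest first, and the cells from the
   head rightwards; all cells not listed are blank. *)
Record tape (A : Type) := Tape { tleft : seq (cell A); tright : seq (cell A) }.

Definition tape_read (A : Type) (t : tape A) : cell A := head None (tright t).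

Definition tape_write_move (A : Type) (t : tape A) (a : cell A * move) :
    tape A :=
  let: (c, m) := a in
  let: r := behead (tright t) in
  match m with
  | MoveL => Tape (behead (tleft t)) (head None (tleft t) :: c :: r)
  | MoveN => Tape (tleft t) (c :: r)
  | MoveR => Tape (c :: tleft t) r
  end.

Section Run.
Variable M : turing_machine.

Record config := Config {
  cfg_state : tm_state M;
  cfg_tapes : {ffun 'I_(tm_tapes M).+1 -> tape (tm_work M)} }.

Definition tm_init (w : seq bool) : config :=
  Config (tm_start M)
    [ffun i => Tape [::] (if i == ord0 then [seq Some (inl b) | b <- w]
                          else [::])].

Definition tm_step (c : config) : config :=
  if tm_halt (cfg_state c) then c else
  let: (q, a) := tm_trans (cfg_state c)
                   [ffun i => tape_read (cfg_tapes c i)] in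
  Config q [ffun i => tape_write_move (cfg_tapes c i) (a i)].

(* The maximal string of bits starting at the head. *)
Fixpoint read_bits (A : Type) (r : seq (cell A)) : seq bool :=
  if r is Some (inl b) :: r' then b :: read_bits r' else [::].

Definition tm_output (c : config) : seq bool :=
  read_bits (tright (cfg_tapes c ord0)).

(* [tm_step] fixes halted configurations, so this says that the machine halts
   after at most [t] steps. *)
Definition tm_computes_within (t : nat) (w out : seq bool) : Prop :=
  let: c := iter t tm_step (tm_init w) in
  tm_halt (cfg_state c) /\ tm_output c = out.

End Run.

Definition polynomially_bounded (p : nat -> nat) : Prop :=
  exists a d : nat, forall n, p n <= a * n ^ d + a.

Definition big_O (f g : nat -> nat) : Prop :=
  exists a n0 : nat, forall n, n0 <= n -> f n <= a * g n.

(* [P] is a parameterized graph problem.  The machine is deterministic, so the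
   output instance [(G', k')] is determined by the input [(G, k)] up to
   isomorphism. *)
Definition admits_kernel (P : sgraph -> nat -> Prop) (f : nat -> nat) : Prop :=
  exists (M : turing_machine) (p h : nat -> nat),
    polynomially_bounded p /\
    forall (G : sgraph) (k : nat), exists (G' : sgraph) (k' : nat),
      [/\ tm_computes_within M (p (size (encode G k)))
            (encode G k) (encode G' k'),
          P G k <-> P G' k',
          #|G'| <= f k
        & k' <= h k].

(* Main.v *)
(** A set of identifications is a partition of the vertices; let X be the union
    of its non-singleton parts, so |X| <= 2k for a solution.  Two rules only
    delete edges and preserve the answer.
    - If a and b have a common neighbour w and 2k+2 further ones, delete aw:
      two of the others are singleton parts, so a and b must lie in one part
      (otherwise the quotient has a 4-cycle), and there aw is parallel to bw.
    - Delete bridges: a solution for the rest can be refined so that no part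
      meets both sides, and adding a bridge to a forest gives a forest.
    In a bridgeless graph X is a vertex cover, and every non-isolated vertex
    outside X has two neighbours in X, so after exhaustive application a
    yes-instance has at most 2k + (2k)^2 (2k+2) <= 18 k^3 non-isolated vertices;
    otherwise the triangle with parameter 0 is output.

    The Turing machine is compiled from a small register language whose loops
    run over variables that the loop body cannot assign and that are bounded by
    n or k, so that every program runs in polynomial time.  *)
Require Import Defs.
From mathcomp Require Import all_boot.
From mathcomp Require Import zify.
From Stdlib Require Import FunctionalExtensionality.

Set Implicit Arguments.
Unset Strict Implicit.
Unset Printing Implicit Defensive.

(** Since the rules delete nothing but edges, the vertex set, the size of the adjacency matrix and
    the parameter stay fixed; isolated vertices are dropped only when the result is written. The
    rules are proved for partitions rather than for sequences of identifications, because it is the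
    refinement of a partition that keeps the budget at a bridge. A forest is treated as a graph all
    of whose edges are bridges: this property is transported to quotients and subgraphs by pushing
    walks along maps, and no cycle has to be rotated. Polynomial time refers to Turing machines, so
    the running time and the growth of the counters are bounded by recursion on the program text,
    uniformly in n and k. *)

Lemma cardsU_leq (T : finType) (A B : {set T}) : #|A :|: B| <= #|A| + #|B|.
Proof. by rewrite cardsU leq_subr. Qed.

(** Origin of the constant: 4k^2 (2k+2) = 8k^3 + 8k^2, and 2k and 8k^2 are rounded up to multiples
    of k^3, which gives 2 + 8 + 8 = 18. *)
Lemma cubic_bound k x b : x <= 2 * k -> b <= x * x * (2 * k + 2) -> x + b <= 18 * k ^ 3.
Proof.
move=> hx hb.
have k2 : k ^ 2 <= k ^ 3 by case: k {hx hb} => // m; rewrite leq_pexp2l.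
have k1 : k <= k ^ 2 by case: k {hx hb k2} => // m; rewrite expnS expn1 leq_pmull.
have h : x * x * (2 * k + 2) <= 2 * k * (2 * k) * (2 * k + 2).
  by rewrite leq_mul2r leq_mul ?orbT.
have E : 2 * k * (2 * k) * (2 * k + 2) = 8 * k ^ 3 + 8 * k ^ 2.
  by clear; rewrite !expnS expn0; lia.
rewrite {}E in h; have {hb h} hb := leq_trans hb h.
move: (k ^ 3) (k ^ 2) k1 k2 hx hb => p q; lia.
Qed.

(** * Acyclic relations and identifications *)

Section Edges.
Variable V : finType.
Implicit Types e : rel V.

Definition same_edge (a b x y : V) :=
  ((x == a) && (y == b)) || ((x == b) && (y == a)).

Definition del_edge e a b : rel V := [rel x y | e x y && ~~ same_edge a b x y].

(** Every edge is a bridge. Unlike the absence of long cycles, this form is easy to transport along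
    maps and to extend by an edge. *)
Definition acyclic e := forall x y, e x y -> ~~ connect (del_edge e x y) x y.

End Edges.

Section EdgeTheory.
Variable V : finType.
Implicit Types e : rel V.

Lemma same_edge_sym (a b : V) : symmetric (same_edge a b).
Proof.
by move=> x y; rewrite /same_edge orbC; congr orb; rewrite andbC.
Qed.

Lemma del_edge_sym e a b : symmetric e -> symmetric (del_edge e a b).
Proof. by move=> se x y; rewrite /del_edge /= se same_edge_sym. Qed.

Lemma del_edge_sub e a b : subrel (del_edge e a b) e.
Proof. by move=> x y /andP[]. Qed.

(** Induction along the walk. The invariant [P] makes a property of the vertices already reached,
    such as lying in a given component, available at each edge. *)
Lemma connect_hom (W : finType) e (e' : rel W) (P : V -> Prop) (h : V -> W) :
  (forall x y, P x -> e x y -> P y /\ connect e' (h x) (h y)) ->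
  forall x y, P x -> connect e x y -> P y /\ connect e' (h x) (h y).
Proof.
move=> H x y Px /connectP[p]; elim: p x Px => [|z p IH] x Px /=.
  by move=> _ ->.
move=> /andP[exz pz] yl; have [Pz cz] := H _ _ Px exz.
by have [Py cy] := IH _ Pz pz yl; split=> //; apply: connect_trans cz cy.
Qed.

(** A detour around the edge xy stays in the component of x, where [h] is injective; hence its image
    avoids the edge between [h x] and [h y] and is a detour around it. *)
Lemma acyclic_inj (W : finType) e (e' : rel W) (h : V -> W) :
  (forall x y, e x y -> e' (h x) (h y)) ->
  (forall x u v, connect e x u -> connect e x v -> h u = h v -> u = v) ->
  acyclic e' -> acyclic e.
Proof.
move=> hom inj ac x y exy; apply/negP => c.
have := ac _ _ (hom _ _ exy); move/negP; apply.
pose P u := connect e x u.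
suff H u v : P u -> del_edge e x y u v ->
    P v /\ connect (del_edge e' (h x) (h y)) (h u) (h v).
  by have [] := connect_hom H (connect0 _ _) c.
move=> Pu /andP[euv nuv].
have Pv : P v by apply: connect_trans Pu (connect1 euv).
have Px : P x := connect0 _ _.
have Py : P y := connect1 exy.
split=> //; apply: connect1; rewrite /del_edge /= (hom _ _ euv) /=.
apply: contra nuv; rewrite /same_edge.
by case/orP=> /andP[/eqP h1 /eqP h2];
  rewrite (inj _ _ _ Pu _ h1) // (inj _ _ _ Pv _ h2) // !eqxx ?orbT.
Qed.

Lemma acyclic_sub e e' : subrel e e' -> acyclic e' -> acyclic e.
Proof. by move=> sub; apply: (acyclic_inj (h := id)). Qed.

Definition add_edge e a b : rel V := [rel x y | e x y || same_edge a b x y].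

Lemma connect_add_edge e a b x y : symmetric e ->
  connect (add_edge e a b) x y ->
  [\/ connect e x y, connect e x a /\ connect e b y
    | connect e x b /\ connect e a y].
Proof.
move=> se /connectP[p]; elim: p x => [|z p IH] x /=.
  by move=> _ ->; constructor 1.
move=> /andP[/orP[exz|sxz] pz] yl.
  have c := connect1 exz.
  case: (IH _ pz yl) => [H|[H1 H2]|[H1 H2]].
  - by constructor 1; apply: connect_trans c H.
  - by constructor 2; split=> //; apply: connect_trans c H1.
  - by constructor 3; split=> //; apply: connect_trans c H1.
case/orP: sxz => /andP[/eqP ? /eqP ?]; subst x z;
  case: (IH _ pz yl) => [H|[H1 H2]|[H1 H2]].
- by constructor 2.
- by constructor 2.
- by constructor 1.
- by constructor 3.
- by constructor 1.
- by constructor 3.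
Qed.

(** A detour around an old edge xy must use the new edge ab; the rest of the detour together with xy
    then joins a to b inside [e]. *)
Lemma acyclic_add_edge e a b : symmetric e -> acyclic e ->
  ~~ connect e a b -> acyclic (add_edge e a b).
Proof.
move=> se ac nab x y; have cs := sym_connect_sym se.
have sub u v : del_edge (add_edge e a b) x y u v -> add_edge (del_edge e x y) a b u v.
  by move=> /andP[/orP[euv|suv] n]; apply/orP; [left; apply/andP|right].
case sab: (same_edge a b x y).
  move=> _; apply/negP => c.
  suff : connect e x y.
    by case/orP: sab nab => /andP[/eqP-> /eqP->]; rewrite ?(cs b) => /negP.
  apply: connect_sub c => u v /andP[/orP[euv _|suv nuv]]; first exact: connect1.
  case/negP: nuv; case/orP: sab suv => /andP[/eqP-> /eqP->] //.
  by rewrite /same_edge orbC.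
rewrite /add_edge /= sab orbF => exy; apply/negP => c.
have {c} c : connect (add_edge (del_edge e x y) a b) x y.
  by apply: connect_sub c => u v /sub H; apply: connect1.
have toe u v : connect (del_edge e x y) u v -> connect e u v.
  by apply: connect_sub => ? ? /del_edge_sub H; apply: connect1.
case: (connect_add_edge (del_edge_sym _ _ se) c) => [H|[/toe H1 /toe H2]|[/toe H1 /toe H2]].
- by have := ac _ _ exy; rewrite H.
- case/negP: nab; rewrite cs in H1.
  by apply: connect_trans H1 _; rewrite cs; apply: connect_trans H2 _; rewrite cs connect1.
- case/negP: nab; apply: connect_trans H2 _; rewrite cs.
  by rewrite cs in H1; apply: connect_trans H1 (connect1 exy).
Qed.

(** The cycle minus its first edge xy is a detour around xy: its third vertex differs from x, and
    the part after y never returns to y. *)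
Lemma ucycle_not_acyclic e (c : seq V) : symmetric e ->
  ucycle e c -> 2 < size c -> ~ acyclic e.
Proof.
move=> se; case: c => [|x [|y [|z p]]] //= /andP[/=].
case/and3P=> exy eyz pz /and4P[].
rewrite !inE !negb_or => /and3P[nxy nxz xp] /andP[nyz yp] _ _ _ ac.
case/negP: (ac _ _ exy); rewrite (sym_connect_sym (del_edge_sym _ _ se)).
apply: (@connect_trans _ _ z).
  apply: connect1; rewrite /del_edge /= eyz /same_edge eqxx /=.
  by rewrite eq_sym (negPf nxy) /= eq_sym.
apply/connectP; exists (rcons p x); last by rewrite last_rcons.
apply: (sub_in_path (P := predC1 y)) pz => [u v|].
  rewrite !inE => /negPf nu /negPf nv euv.
  by rewrite /del_edge /= euv /same_edge nu nv andbF.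
rewrite /= eq_sym nyz all_rcons /= nxy /=.
by apply/allP => w wp /=; apply: contraNneq yp => <-.
Qed.

Lemma acyclic_no_ucycle e : symmetric e -> irreflexive e ->
  acyclic e <-> ~ exists c : seq V, ucycle e c /\ 2 < size c.
Proof.
move=> se ie; split=> [ac [c [uc sc]]|nc x y exy].
  exact: ucycle_not_acyclic uc sc ac.
apply/negP => /connectP[p0]; case/shortenP=> p pp up _ yl; case: nc.
exists (x :: p); split.
  rewrite /ucycle up andbT /= rcons_path -yl (se y x) exy andbT.
  by apply: sub_path pp; apply: del_edge_sub.
(* A simple detour with no edge would make the edge a loop, and one with a single edge would be the
   deleted edge itself. *)
case: p pp yl {up} => [|z [|w p]] //=; first by move=> _ yx; rewrite yx ie in exy.
by rewrite andbT => /andP[_ /negP n] yz; case: n; rewrite yz /same_edge !eqxx.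
Qed.

End EdgeTheory.

(** * Quotients by a labelling and the two reduction rules *)

Section Quotient.
Variable V : finType.

(** The simple quotient graph: loops vanish and parallel edges merge, just as under
    identification. *)
Definition qrel (W : finType) (f : V -> W) (e : rel V) : rel W :=
  [rel a b | (a != b) && [exists x, exists y, [&& f x == a, f y == b & e x y]]].

Lemma qrelP (W : finType) (f : V -> W) (e : rel V) a b :
  reflect (a <> b /\ exists x y, [/\ f x = a, f y = b & e x y]) (qrel f e a b).
Proof.
apply: (iffP andP) => [[/eqP nab /existsP[x /existsP[y /and3P[/eqP ? /eqP ? ?]]]]|].
  by split=> //; exists x, y.
case=> /eqP nab [x [y [fx fy exy]]]; split=> //.
by apply/existsP; exists x; apply/existsP; exists y; rewrite fx fy !eqxx.
Qed.

Lemma qrel_sym (W : finType) (f : V -> W) (e : rel V) :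
  symmetric e -> symmetric (qrel f e).
Proof.
move=> se a b; apply/qrelP/qrelP => -[nab [x [y [fx fy exy]]]];
  by split; [move=> E; case: nab|exists y, x; rewrite se].
Qed.

Lemma qrel_edge (W : finType) (f : V -> W) (e : rel V) x y :
  f x <> f y -> e x y -> qrel f e (f x) (f y).
Proof. by move=> nf exy; apply/qrelP; split=> //; exists x, y. Qed.

Lemma qrel_mono (W : finType) (f : V -> W) (e e' : rel V) :
  subrel e e' -> subrel (qrel f e) (qrel f e').
Proof.
move=> sub a b /qrelP[nab [x [y [fx fy exy]]]].
by apply/qrelP; split=> //; exists x, y; split=> //; apply: sub.
Qed.

(** Only labels in the image count as parts. The budget is written additively because subtraction of
    natural numbers truncates. *)
Definition solution (e : rel V) (k : nat) (W : finType) (f : V -> W) :=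
  acyclic (qrel f e) /\ #|V| <= #|f @: [set: V]| + k.

(* A set of identifications is a partition of the vertices, given by a
   labelling; it takes #|V| - #|image| identifications to carry it out. *)
Definition solvable (e : rel V) (k : nat) :=
  exists (W : finType) (f : V -> W), solution e k f.

Lemma solvable_sub (e e' : rel V) k : subrel e e' -> solvable e' k -> solvable e k.
Proof.
move=> sub [W [f [ac c]]]; exists W, f; split=> //.
exact: acyclic_sub (qrel_mono sub) ac.
Qed.

Definition nonsingle (W : finType) (f : V -> W) : {set V} :=
  [set x | [exists y, (y != x) && (f y == f x)]].

Lemma singleP (W : finType) (f : V -> W) x y :
  x \notin nonsingle f -> f y = f x -> y = x.
Proof.
rewrite inE negb_exists => /forallP/(_ y) /=.
by rewrite negb_and negbK => /orP[/eqP//|/eqP].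
Qed.

(** Every part inside X has at least two elements, so X carries at most |X|/2 labels. The labelling
    loses at most k labels in all, hence |X| - |X|/2 <= k. *)
Lemma card_nonsingle (W : finType) (f : V -> W) k :
  #|V| <= #|f @: [set: V]| + k -> #|nonsingle f| <= 2 * k.
Proof.
set X := nonsingle f => cV.
have c2 : 2 * #|f @: X| <= #|X|.
  rewrite -[#|X|]sum1_card (partition_big_imset f) /= mulnC -sum_nat_const.
  apply: leq_sum => y /imsetP[x xX ->]; rewrite sum1_card.
  move: (xX); rewrite inE => /existsP[z /andP[nzx /eqP fz]].
  have zX : z \in X by rewrite inE; apply/existsP; exists x; rewrite eq_sym nzx fz /=.
  (* The number 2 is rewritten as the cardinality of the pair {z, x}, which lies in the fibre of
     x. *)
  rewrite -[2]/(true.+1) -nzx -cards2; apply: subset_leq_card; apply/subsetP => w.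
  by rewrite !inE => /orP[] /eqP->; rewrite unfold_in /= ?zX ?xX ?fz eqxx.
move: cV; rewrite -[[set: V]](setUCr X) imsetU => cV.
have := cardsU_leq (f @: X) (f @: ~: X); have := leq_imset_card f (~: X).
move: (cardsC X) c2 cV => /=; lia.
Qed.

Lemma forced_merge (e : rel V) k (W : finType) (f : V -> W) a b (C : {set V}) :
  symmetric e -> irreflexive e -> solution e k f -> {in C, forall w, e a w && e b w} ->
  2 * k + 2 <= #|C| -> f a = f b.
Proof.
move=> se ie [ac cV] Cw cC; case: (f a =P f b) => // nab.
have cX := card_nonsingle cV.
have : 1 < #|C :\: nonsingle f|.
  by have := cardsID (nonsingle f) C; have := subset_leq_card (subsetIr C (nonsingle f)); lia.
case/card_gt1P=> x [y [xC yC nxy]]; move: xC yC; rewrite !in_setD.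
case/andP=> sx /Cw /andP[eax ebx] /andP[sy /Cw /andP[eay eby]].
have ne u v : v \notin nonsingle f -> e u v -> f u <> f v.
  by move=> sv euv /(singleP sv) E; rewrite E ie in euv.
have nfxy : f x <> f y by move/(singleP sy) => E; rewrite E eqxx in nxy.
have q u v (nuv : f u <> f v) (euv : e u v) := qrel_edge nuv euv.
have qs := qrel_sym f se.
have qax := q _ _ (ne _ _ sx eax) eax; have qbx := q _ _ (ne _ _ sx ebx) ebx.
have qay := q _ _ (ne _ _ sy eay) eay; have qby := q _ _ (ne _ _ sy eby) eby.
exfalso; apply: (@ucycle_not_acyclic _ (qrel f e) [:: f a; f x; f b; f y]) ac => //.
rewrite /ucycle /cycle [path _ _ _]/= !andbT qax (qs _ (f b)) qbx qby (qs _ (f a)) qay.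
have /eqP nax := ne _ _ sx eax; have /eqP nbx := ne _ _ sx ebx.
have /eqP nay := ne _ _ sy eay; have /eqP nby := ne _ _ sy eby.
move/eqP: nab => nab; move/eqP: nfxy => nfxy.
by rewrite /= !inE !negb_or nax nab nay nfxy nby eq_sym nbx.
Qed.

(* The surviving common neighbours force a and b into one part, where the
   deleted edge is parallel to b-w. *)
Lemma twin_rule (e : rel V) k a b w (C : {set V}) :
  symmetric e -> irreflexive e -> a != b -> w \notin C ->
  {in w |: C, forall w, e a w && e b w} -> 2 * k + 2 <= #|C| ->
  solvable (del_edge e a w) k -> solvable e k.
Proof.
move=> se ie nab wC Cw cC [W [f sol]]; exists W, f.
have ewa : e a w && e b w by apply: Cw; rewrite setU11.
have fab : f a = f b.
  apply: (forced_merge (C := C) (del_edge_sym _ _ se) _ sol) => //.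
    by move=> x; rewrite /del_edge /= ie.
  move=> z zC; have /andP[eaz ebz] : e a z && e b z by apply: Cw; rewrite setU1r.
  have nzw : z != w by apply: contraNneq wC => <-.
  rewrite /del_edge /= eaz ebz /same_edge eqxx (negPf nzw) /=.
  have naz : a != z by apply: contraTneq eaz => <-; rewrite ie.
  rewrite (eq_sym b a) (negPf nab) /= (eq_sym z a) (negPf naz) !andbF //.
case: sol => ac cV; split=> //; apply: acyclic_sub ac => x y.
case/qrelP=> nxy [u [v [fu fv euv]]].
case s: (same_edge a w u v); last first.
  by apply/qrelP; split=> //; exists u, v; rewrite /del_edge /= euv s.
have ebw : del_edge e a w b w.
  case/andP: ewa => eaw ebw; rewrite /del_edge /= ebw /same_edge (eq_sym b a) (negPf nab) /=.
  by rewrite negb_and orbC eq_sym; case: eqP eaw => // ->; rewrite ie.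
apply/qrelP; split=> //; case/orP: s => /andP[/eqP Eu /eqP Ev]; subst u v.
  by exists b, w; split=> //; rewrite -fab.
by exists w, b; split=> //; [rewrite -fab|rewrite del_edge_sym].
Qed.

(** Each label is paired with the side of the bridge, namely whether a reaches the vertex without
    it. Refining cannot shrink the image, so the budget is kept. Connected labels share their side,
    so forgetting the side is injective on components and [acyclic_inj] applies. *)
Lemma bridge_rule (e : rel V) k a b :
  symmetric e -> ~~ connect (del_edge e a b) a b ->
  solvable (del_edge e a b) k -> solvable e k.
Proof.
set e' := del_edge e a b => se nc [W [f [ac cV]]].
have se' : symmetric e' := del_edge_sym a b se.
pose f' x := (f x, connect e' a x).
exists (W * bool)%type, f'; split; last first.
  apply: leq_trans cV _; rewrite leq_add2r.
  have -> : f @: [set: V] = fst @: (f' @: [set: V]).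
    by rewrite -imset_comp; apply: eq_imset.
  exact: leq_imset_card.
have side x y : qrel f' e' x y -> y.2 = x.2.
  case/qrelP=> _ [u [v [<- <- euv]]] /=; apply/idP/idP => c.
    by apply: connect_trans c _; rewrite (sym_connect_sym se') connect1.
  exact: connect_trans c (connect1 euv).
have sides x y : connect (qrel f' e') x y -> y.2 = x.2.
  move=> c; pose P (z : W * bool) := z.2 = x.2.
  (* Only the invariant of [connect_hom] matters here, so the target is the one-point graph. *)
  suff [//] : P y /\ connect (fun _ _ : unit => true) tt tt.
  apply: (connect_hom (h := fun _ => tt) _ (erefl : P x) c) => u v Pu euv.
  by split; [rewrite /P (side _ _ euv)|].
have ac' : acyclic (qrel f' e').
  apply: (acyclic_inj (h := fst)) ac => [x y qxy|x u v /sides xu /sides xv Euv].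
    have s := side _ _ qxy; case/qrelP: qxy => nxy [u [v [fu fv euv]]].
    apply/qrelP; split; last by exists u, v; rewrite -fu -fv.
    by move=> E; case: nxy; move: x y s E {fu fv} => [x1 x2] [y1 y2] /= -> ->.
  by move: u v xu xv Euv => [u1 u2] [v1 v2] /= -> -> ->.
apply: acyclic_sub (_ : acyclic (add_edge (qrel f' e') (f' a) (f' b))).
  move=> x y /qrelP[nxy [u [v [fu fv euv]]]]; apply/orP.
  case s: (same_edge a b u v); last first.
    by left; apply/qrelP; split=> //; exists u, v; rewrite /e' /del_edge /= euv s.
  right; rewrite -fu -fv; case/orP: s => /andP[/eqP-> /eqP->];
    by rewrite /same_edge !eqxx ?orbT.
apply: acyclic_add_edge (qrel_sym _ se') ac' _.
by apply/negP => /sides /=; rewrite connect0 (negPf nc).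
Qed.

Lemma reduced_card (e : rel V) k :
  symmetric e -> irreflexive e ->
  (forall a b, e a b -> connect (del_edge e a b) a b) ->
  (forall a b, a != b -> #|[set w | e a w && e b w]| <= 2 * k + 2) ->
  solvable e k -> #|[set x | [exists y, e x y]]| <= 18 * k ^ 3.
Proof.
move=> se ie nb few [W [f [ac cV]]]; set X := nonsingle f.
have cX : #|X| <= 2 * k := card_nonsingle cV.
have cover x y : e x y -> x \notin X -> y \in X.
  move=> exy sx; apply/negPn/negP => sy.
  have nf : f x <> f y by move/(singleP sy) => E; rewrite E ie in exy.
  case/negP: (ac _ _ (qrel_edge nf exy)).
  suff H u v : True -> del_edge e x y u v ->
      True /\ connect (del_edge (qrel f e) (f x) (f y)) (f u) (f v).
    by have [] := connect_hom H I (nb _ _ exy).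
  move=> _ /andP[euv /negP nuv]; split=> //; case: (f u =P f v) => [->|nfuv].
    exact: connect0.
  apply: connect1; apply/andP; split; first exact: qrel_edge.
  apply/negP => /orP[]/andP[/eqP h1 /eqP h2]; case: nuv; rewrite /same_edge.
    by rewrite (singleP sx h1) (singleP sy h2) !eqxx.
  by rewrite (singleP sy h1) (singleP sx h2) !eqxx orbT.
have sub : [set x | [exists y, e x y]] \subset
    X :|: \bigcup_(p in setX X X | p.1 != p.2) [set w | e p.1 w && e p.2 w].
  apply/subsetP => x; rewrite in_set in_setU => /existsP[u exu].
  case xX: (x \in X) => //=.
  (* The detour around the edge from x to u leaves x by another edge, and its end v is the second
     neighbour. *)
  have /connectP[[|v p] /=] := nb _ _ exu.
    by move=> _ E; rewrite E ie in exu.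
  move=> /andP[/andP[exv /negP nv] _] _.
  have nuv : u != v by apply/eqP => E; apply: nv; rewrite E /same_edge !eqxx.
  apply/bigcupP; exists (u, v).
    by rewrite in_setX /= nuv andbT (cover x u) ?(cover x v) ?xX.
  by rewrite inE /= !(se _ x) exu.
apply: leq_trans (subset_leq_card sub) _.
apply: leq_trans (cardsU_leq _ _) _.
have : #|\bigcup_(p in setX X X | p.1 != p.2) [set w | e p.1 w && e p.2 w]|
    <= \sum_(p in setX X X) (2 * k + 2).
  (* The sum runs over all ordered pairs of X; the diagonal pairs, to which [few] does not apply,
     contribute the empty set. *)
  rewrite big_mkcondr /=.
  elim/big_ind2: _ => [|A x B y hA hB|p _]; first by rewrite cards0.
    by apply: leq_trans (cardsU_leq _ _) _; apply: leq_add.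
  by case: ifP => [/few//|_]; rewrite cards0.
rewrite sum_nat_const cardsX => H.
exact: cubic_bound cX H.
Qed.

End Quotient.

(** * Change of vertex set and the link with sequences of identifications *)

Lemma solvable_bij (V V' : finType) (h : V -> V') (g : V' -> V) (e : rel V) k :
  cancel h g -> cancel g h ->
  solvable e k <-> solvable [rel x y | e (g x) (g y)] k.
Proof.
move=> hK gK; have cE : #|V| = #|V'| by apply: bij_eq_card; exists g.
split=> -[W [f [ac c]]].
  exists W, (f \o g); split.
    apply: acyclic_sub ac => a b /qrelP[nab [x [y [fx fy exy]]]].
    by apply/qrelP; split=> //; exists (g x), (g y).
  rewrite -cE imset_comp; suff -> : g @: [set: V'] = [set: V] by [].
  by apply/setP => x; rewrite inE; apply/imsetP; exists (h x); rewrite ?hK.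
exists W, (f \o h); split.
  apply: acyclic_sub ac => a b /qrelP[nab [x [y [fx fy exy]]]].
  by apply/qrelP; split=> //; exists (h x), (h y); split=> //=; rewrite !hK.
rewrite cE imset_comp; suff -> : h @: [set: V] = [set: V'] by [].
by apply/setP => x; rewrite inE; apply/imsetP; exists (g x); rewrite ?gK.
Qed.

(** Vertices outside the range of [h] are isolated. Restricting a labelling loses at most one label
    for each of them; conversely each receives a private label [inr x], which leaves the budget
    unchanged. *)
Lemma solvable_support (V U : finType) (h : U -> V) (e : rel V) k :
  injective h -> (forall x y, e x y -> x \in codom h) -> symmetric e ->
  solvable e k <-> solvable [rel x y | e (h x) (h y)] k.
Proof.
move=> hinj he se; have cS : #|h @: [set: U]| = #|U| by rewrite card_imset // cardsT.
have cC : #|V| = #|U| + #|~: (h @: [set: U])| by rewrite -cS cardsC.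
split=> -[W [f [ac c]]].
  exists W, (f \o h); split.
    apply: acyclic_sub ac => a b /qrelP[nab [x [y [fx fy exy]]]].
    by apply/qrelP; split=> //; exists (h x), (h y).
  rewrite imset_comp; move: c; rewrite -[[set: V]](setUCr (h @: [set: U])) imsetU.
  have := cardsU_leq (f @: (h @: [set: U])) (f @: ~: (h @: [set: U])).
  have := leq_imset_card f (~: (h @: [set: U])); lia.
pose g x : W + V := if [pick u | h u == x] is Some u then inl (f u) else inr x.
have gh u : g (h u) = inl (f u).
  by rewrite /g; case: pickP => [v /eqP/hinj-> //|/(_ u)]; rewrite eqxx.
exists (W + V)%type, g; split.
  have ing x y : qrel g e x y ->
      exists u v, [/\ x = inl (f u), y = inl (f v), f u <> f v & e (h u) (h v)].
    case/qrelP=> nxy [a [b [Ex Ey eab]]].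
    have /codomP[u Eu] := he _ _ eab; rewrite se in eab.
    have /codomP[v Ev] := he _ _ eab; subst a b; rewrite se in eab.
    by exists u, v; rewrite -Ex -Ey !gh; split=> // E; apply: nxy; rewrite -Ex -Ey !gh E.
  move=> x y qxy; have [u [v [Ex Ey nuv euv]]] := ing _ _ qxy; apply/negP => cxy.
  case/negP: (ac _ _ (qrel_edge (e := [rel x y | e (h x) (h y)]) nuv euv)).
  (* The default [f u] is never met along an edge: both ends of a quotient edge are labels of the
     form [inl]. *)
  pose p (z : W + V) := if z is inl w then w else f u.
  suff H a b : True -> del_edge (qrel g e) x y a b -> True /\
      connect (del_edge (qrel f [rel x y | e (h x) (h y)]) (f u) (f v)) (p a) (p b).
    by have [_] := connect_hom H I cxy; rewrite Ex Ey.
  move=> _ /andP[/ing[u' [v' [Ea Eb nuv' euv']]] nab]; split=> //.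
  apply: connect1; rewrite Ea Eb /= /del_edge /=.
  have := qrel_edge (e := [rel x y | e (h x) (h y)]) nuv' euv'; rewrite /= => ->.
  by move: nab; rewrite Ea Eb Ex Ey.
have -> : [set: V] = h @: [set: U] :|: ~: (h @: [set: U]) by rewrite setUCr.
rewrite imsetU cardsU.
have c1 : #|g @: (h @: [set: U])| = #|f @: [set: U]|.
  rewrite -imset_comp -(card_imset _ (@inl_inj W V)) -imset_comp; congr #|pred_of_set _|.
  by apply: eq_imset => u /=; rewrite gh.
have gC x : x \in ~: (h @: [set: U]) -> g x = inr x.
  rewrite inE /g => nx; case: pickP => // u /eqP E.
  by case/negP: nx; rewrite -E imset_f.
have c2 : #|g @: ~: (h @: [set: U])| = #|~: (h @: [set: U])|.
  by apply: card_in_imset => x y xC yC; rewrite !gC // => -[].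
have -> : g @: (h @: [set: U]) :&: g @: (~: (h @: [set: U])) = set0.
  apply/setP => z; rewrite in_set0; apply/negP; rewrite inE => /andP[].
  case/imsetP=> a /imsetP[u _ ->] ->; rewrite gh; case/imsetP=> b bC.
  by rewrite gC.
rewrite cards0 subn0 c1 c2; lia.
Qed.

Lemma forest_acyclic (G : sgraph) : forest G <-> acyclic (@adj G).
Proof. by symmetry; apply: acyclic_no_ucycle; [apply: adj_sym|apply: adj_irrefl]. Qed.

Lemma card_identify (G : sgraph) (u v : G) : u != v -> #|G| = #|identify u v|.+1.
Proof.
move=> nuv; rewrite card_option card_sig -(cardC (pred2 u v)) card2 nuv; congr _.+2.
by apply: eq_card => x; rewrite !inE negb_or.
Qed.

(** One identification is the surjection [pi], which sends u and v to [None] because [insub] fails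
    on them. Composing a labelling with it costs one more unit, for the vertex lost. *)
Lemma identifications_solvable j (G H : sgraph) :
  identifications j G H -> forest H -> solvable (@adj G) j.
Proof.
elim=> {j G H} [G /forest_acyclic ac|j G H u v nuv _ IH fH].
  exists G, id; split; last by rewrite imset_id cardsT addn0.
  apply: acyclic_sub ac => a b /qrelP[_ [x [y [<- <- //]]]].
have [W [f [ac c]]] := IH fH.
pose pi (x : G) : identify u v := insub x.
have piP x : (pi x = None /\ x \in [:: u; v]) \/ exists a, pi x = Some a /\ val a = x.
  rewrite /pi; case: insubP => [a _ <-|]; first by right; exists a.
  by rewrite negb_and !negbK => H'; left; rewrite !inE.
exists W, (f \o pi); split.
  apply: acyclic_sub ac => a b /qrelP[nab [x [y [fx fy exy]]]]; apply/qrelP; split=> //.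
  exists (pi x), (pi y); split=> //.
  case: (piP x) => [[Ex xI]|[a' [Ex Vx]]]; case: (piP y) => [[Ey yI]|[b' [Ey Vy]]].
  - by case: nab; rewrite -fx -fy /= Ex Ey.
  - by rewrite Ex Ey /= Vy; move: xI exy; rewrite !inE => /orP[]/eqP-> ->; rewrite ?orbT.
  - by rewrite Ex Ey /= Vx; move: yI exy; rewrite !inE adj_sym => /orP[]/eqP-> ->; rewrite ?orbT.
  - by rewrite Ex Ey /= Vx Vy.
rewrite (card_identify nuv) imset_comp.
have -> : pi @: [set: G] = [set: identify u v].
  apply/setP => -[a|]; rewrite inE; apply/imsetP.
    by exists (val a) => //; rewrite /pi valK.
  by exists u => //; rewrite /pi insubF // eqxx.
lia.
Qed.

(** With budget 0 the labelling is injective and the graph is already a forest. Otherwise two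
    vertices sharing a label are identified, and the labelling factors through the result with the
    same image; if there are none, a smaller budget suffices. *)
Lemma solvable_identifications k (G : sgraph) :
  solvable (@adj G) k -> forest_identification G k.
Proof.
case=> W [f]; elim: k G f => [|k IH] G f [ac c].
  exists 0, G; split=> //; first by constructor.
  have finj : injective f.
    have := leq_imset_card f [set: G]; rewrite cardsT => c'.
    have /imset_injP H : #|f @: [set: G]| == #|[set: G]| by rewrite cardsT; lia.
    by move=> x y; apply: H; rewrite inE.
  apply/forest_acyclic; apply: (acyclic_inj (h := f)) ac => [x y exy|x u v _ _ /finj//].
  by apply: qrel_edge => // /finj E; rewrite E adj_irrefl in exy.
case finj: (injectiveb f).
  have [] := IH G f; last by move=> j [H [hj ? ?]]; exists j, H; split=> //; apply: leqW.
  split=> //; move/injectiveP: finj => finj; rewrite card_imset // cardsT; lia.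
move/injectivePn: finj => [u [v nuv fuv]].
pose f' (a : identify u v) := if a is Some b then f (val b) else f u.
have [] := IH (identify u v) f'; last first.
  move=> j [H [hj id ?]]; exists j.+1, H; split=> //.
  exact: identificationsS nuv id.
split.
  apply: acyclic_sub ac => a b /qrelP[nab [x [y [fx fy exy]]]]; apply/qrelP; split=> //.
  case: x y fx fy exy => [x|] [y|] //= fx fy.
  - by exists (val x), (val y).
  - by case/orP=> exy; [exists (val x), u|exists (val x), v; rewrite -fuv]; rewrite adj_sym.
  - by case/orP=> exy; [exists u, (val y)|exists v, (val y); rewrite -fuv].
have -> : f' @: [set: identify u v] = f @: [set: G].
  apply/setP => w; apply/imsetP/imsetP => [[[a|] _ ->]|[x _ ->]].
  - by exists (val a).
  - by exists u.
  case xu: (x == u); first by exists None; rewrite ?inE //= (eqP xu).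
  case xv: (x == v); first by exists None; rewrite ?inE //= (eqP xv).
  have px : (x != u) && (x != v) by rewrite xu xv.
  by exists (Some (Sub x px)); rewrite ?inE //= SubK.
by move: c; rewrite (card_identify nuv); lia.
Qed.

Lemma forest_identification_solvable (G : sgraph) k :
  forest_identification G k <-> solvable (@adj G) k.
Proof.
split; last exact: solvable_identifications.
case=> j [H [hj id fH]]; have [W [f [ac c]]] := identifications_solvable id fH.
by exists W, f; split=> //; lia.
Qed.

(** * Structured programs for Turing machines *)

Definition upd (A : Type) (f : nat -> A) (i : nat) (v : A) : nat -> A :=
  fun j => if j == i then v else f j.

Lemma upd_same (A : Type) (f : nat -> A) i v : upd f i v i = v.
Proof. by rewrite /upd eqxx. Qed.

Lemma upd_id (A : Type) (f : nat -> A) i : upd f i (f i) =1 f.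
Proof. by move=> j; rewrite /upd; case: eqP => [->|]. Qed.

(** The two flags of a work symbol: the first singles out position 0 of a tape, the second is a
    stored bit or an end mark. *)
Definition mark : Type := (bool * bool)%type.
Definition mcell := cell mark.

Section TapeView.
Implicit Types (t : tape mark) (f : nat -> mcell) (p : nat).

(** The tape is used as a one-way infinite one: nothing is listed to the left of position 0, so a
    move to the left must start at a positive position. The right part is compared through [nth]
    because trailing blanks need not be listed. *)
Definition tape_rep t f p :=
  tleft t = rev (mkseq f p) /\ forall j, nth None (tright t) j = f (p + j).

Definition shift (mv : move) p :=
  match mv with MoveL => p.-1 | MoveN => p | MoveR => p.+1 end.

Lemma tape_rep_read t f p : tape_rep t f p -> tape_read t = f p.
Proof. by case=> _ /(_ 0); rewrite addn0 /tape_read nth0. Qed.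

Lemma tape_rep_write t f p c mv : tape_rep t f p -> (mv = MoveL -> 0 < p) ->
  tape_rep (tape_write_move t (c, mv)) (upd f p c) (shift mv p).
Proof.
case: t => l r [/= -> hr] hp.
have eqm q : q <= p -> mkseq (upd f p c) q = mkseq f q.
  move=> hq; apply: (@eq_from_nth _ None) => [|j]; rewrite !size_mkseq // => hj.
  by rewrite !nth_mkseq // /upd; case: eqP => // E; lia.
have mkS q g : rev (mkseq g q.+1) = g q :: rev (mkseq g q) :> seq mcell.
  by rewrite mkseqS rev_rcons.
have right j : nth None (c :: behead r) j = upd f p c (p + j).
  case: j => [|j] /=; first by rewrite addn0 upd_same.
  by rewrite nth_behead hr /upd; case: eqP => // E; lia.
case: mv hp => hp; rewrite /= /tape_rep /=.
- case: p hr eqm right hp => [|p] hr eqm right hp; first by have := hp erefl.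
  rewrite mkS; split; first by rewrite eqm.
  case=> [|j] /=; first by rewrite addn0 /upd; case: eqP => // E; lia.
  by rewrite -[LHS]/(nth None (c :: behead r) j) right addSnnS.
- by split; rewrite ?eqm.
- split; last by move=> j; rewrite nth_behead hr /upd addnS addSn; case: eqP => // E; lia.
  by rewrite mkS upd_same eqm.
Qed.

End TapeView.

Inductive tprog :=
| Act of nat & (mcell -> mcell * move)
| TSeq of tprog & tprog
| TIf of nat & nat & (mcell -> mcell -> bool) & tprog & tprog
| TWhile of nat & nat & (mcell -> mcell -> bool) & tprog.

(** * Structured control as a machine, and its total correctness rules *)

Section Machine.
Variable m : nat.
Notation reads := {ffun 'I_m.+1 -> mcell}.
Notation acts := {ffun 'I_m.+1 -> mcell * move}.
Notation tapes := {ffun 'I_m.+1 -> tape mark}.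

(** For conditionals and loops, [None] is the state in which the test is made. *)
Fixpoint pstate (p : tprog) : finType :=
  match p with
  | Act _ _ => unit
  | TSeq p q => (pstate p + pstate q)%type
  | TIf _ _ _ p q => option (pstate p + pstate q)
  | TWhile _ _ _ p => option (pstate p)
  end.

Fixpoint pstart (p : tprog) : pstate p :=
  match p return pstate p with
  | Act _ _ => tt
  | TSeq p q => inl (pstart p)
  | TIf _ _ _ _ _ => None
  | TWhile _ _ _ _ => None
  end.

Definition keep (rd : reads) : acts := [ffun j => (rd j, MoveN)].

Definition act_on (i : nat) (g : mcell -> mcell * move) (rd : reads) : acts :=
  [ffun j : 'I_m.+1 => if j == i :> nat then g (rd j) else (rd j, MoveN)].

(* [None] means that control leaves the program. *)
Fixpoint pstep (p : tprog) : pstate p -> reads -> option (pstate p) * acts :=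
  match p return pstate p -> reads -> option (pstate p) * acts with
  | Act i g => fun _ rd => (None, act_on i g rd)
  | TSeq p q => fun s rd =>
      match s with
      | inl s => let: (s', a) := pstep s rd in
          (Some (if s' is Some s1 then inl s1 else inr (pstart q)), a)
      | inr s => let: (s', a) := pstep s rd in (omap inr s', a)
      end
  | TIf i j b p q => fun s rd =>
      match s with
      | None => (Some (Some (if b (rd (inord i)) (rd (inord j))
                             then inl (pstart p) else inr (pstart q))), keep rd)
      | Some (inl s) => let: (s', a) := pstep s rd in (omap (Some \o inl) s', a)
      | Some (inr s) => let: (s', a) := pstep s rd in (omap (Some \o inr) s', a)
      end
  | TWhile i j b p => fun s rd =>
      match s with
      | None => (if b (rd (inord i)) (rd (inord j))
                 then Some (Some (pstart p)) else None, keep rd)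
      | Some s => let: (s', a) := pstep s rd in (Some s', a)
      end
  end.

Definition read_all (T : tapes) : reads := [ffun i => tape_read (T i)].
Definition write_all (T : tapes) (a : acts) : tapes :=
  [ffun i => tape_write_move (T i) (a i)].

Inductive runs (p : tprog) : pstate p -> tapes -> nat -> tapes -> Prop :=
| runs_exit s T a : pstep s (read_all T) = (None, a) -> runs s T 1 (write_all T a)
| runs_step s s' T a t T' : pstep s (read_all T) = (Some s', a) ->
    runs s' (write_all T a) t T' -> runs s T t.+1 T'.

Definition machine (p : tprog) : turing_machine :=
  @TuringMachine m mark (option (pstate p)) (Some (pstart p))
    (fun q => ~~ isSome q)
    (fun q rd => if q is Some s then pstep s rd else (None, keep rd)).

Lemma machine_runs p (s : pstate p) T t T' : runs s T t T' ->
  iter t (@tm_step (machine p)) (@Config (machine p) (Some s) T)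
    = @Config (machine p) None T'.
Proof.
elim=> {s T t T'} [s T a E|s s' T a t T' E _ IH].
  by rewrite /= /tm_step /= -[[ffun _ => _]]/(read_all T) E.
by rewrite iterSr {2}/tm_step /= -[[ffun _ => _]]/(read_all T) E.
Qed.

Lemma machine_halted p t T : iter t (@tm_step (machine p)) (@Config (machine p) None T)
  = @Config (machine p) None T.
Proof. by elim: t => //= t ->. Qed.

Lemma runs_seq p q (s : pstate p) T t T' t' T'' :
  runs s T t T' -> runs (pstart q) T' t' T'' ->
  @runs (TSeq p q) (inl s) T (t + t') T''.
Proof.
move=> r1 r2; elim: r1 r2 => {s T t T'} [s T a E|s s' T a t T' E _ IH] r2.
  apply: (@runs_step (TSeq p q) _ (inr (pstart q)) _ a); first by rewrite /= E.
  elim: r2 => {s T a E t' T''} [s T a E|s s' T a t T' E _ IH].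
    by apply: runs_exit; rewrite /= E.
  by apply: (@runs_step (TSeq p q) _ (inr s') _ a) => //; rewrite /= E.
by apply: (@runs_step (TSeq p q) _ (inl s') _ a); [rewrite /= E|apply: IH].
Qed.

Lemma write_keep T : write_all T (keep (read_all T)) =
  [ffun i => tape_write_move (T i) (tape_read (T i), MoveN)].
Proof. by apply/ffunP => i; rewrite !ffunE. Qed.

Lemma runs_if i j b p q T t T' :
  let: bb := b (read_all T (inord i)) (read_all T (inord j)) in
  let: T0 := write_all T (keep (read_all T)) in
  (if bb then runs (pstart p) T0 t T' else runs (pstart q) T0 t T') ->
  @runs (TIf i j b p q) None T t.+1 T'.
Proof.
case E: (b _ _) => r.
- apply: (@runs_step (TIf i j b p q) _ (Some (inl (pstart p))));
    first by rewrite /= E.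
  elim: r => {E T t T'} [s T a E|s s' T a t T' E _ IH].
    by apply: runs_exit; rewrite /= E.
  by apply: (@runs_step (TIf i j b p q) _ (Some (inl s')) _ a) => //; rewrite /= E.
- apply: (@runs_step (TIf i j b p q) _ (Some (inr (pstart q))));
    first by rewrite /= E.
  elim: r => {E T t T'} [s T a E|s s' T a t T' E _ IH].
    by apply: runs_exit; rewrite /= E.
  by apply: (@runs_step (TIf i j b p q) _ (Some (inr s')) _ a) => //; rewrite /= E.
Qed.

Lemma runs_while0 i j b p T :
  ~~ b (read_all T (inord i)) (read_all T (inord j)) ->
  @runs (TWhile i j b p) None T 1 (write_all T (keep (read_all T))).
Proof. by move=> /negPf E; apply: runs_exit; rewrite /= E. Qed.

Lemma runs_whileS i j (b : mcell -> mcell -> bool) p T t T' t' T'' :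
  b (read_all T (inord i)) (read_all T (inord j)) ->
  runs (pstart p) (write_all T (keep (read_all T))) t T' ->
  @runs (TWhile i j b p) None T' t' T'' ->
  @runs (TWhile i j b p) None T (t + t').+1 T''.
Proof.
move=> E r r'; apply: (@runs_step (TWhile i j b p) _ (Some (pstart p))).
  by rewrite /= E.
elim: r r' => {E T t T'} [s T a E|s s' T a t T' E _ IH] r'.
  by apply: (@runs_step (TWhile i j b p) _ None _ a) => //; rewrite /= E.
by apply: (@runs_step (TWhile i j b p) _ (Some s') _ a); [rewrite /= E|apply: IH].
Qed.

(* Contents and head positions of one-way infinite tapes. *)
Record view := View { cont : nat -> nat -> mcell; pos : nat -> nat }.

Definition tapes_rep (T : tapes) (v : view) :=
  forall i : 'I_m.+1, tape_rep (T i) (cont v i) (pos v i).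

(** Total correctness with a time bound. Quantifying over all tapes that represent the view makes
    the statement insensitive to unlisted blanks. *)
Definition reach (p : tprog) (v : view) (t : nat) (v' : view) :=
  forall T, tapes_rep T v -> exists t' T',
    [/\ t' <= t, runs (pstart p) T t' T' & tapes_rep T' v'].

Lemma tapes_rep_ext T v v' : (forall i, cont v i =1 cont v' i) ->
  pos v =1 pos v' -> tapes_rep T v -> tapes_rep T v'.
Proof.
move=> hC hh R i; case: (R i) => l r; rewrite -hh; split; last by move=> j; rewrite -hC.
by rewrite l; congr rev; apply: eq_mkseq.
Qed.

Lemma reach_weak p v t v' t' v'' : reach p v t v' -> t <= t' ->
  (forall i, cont v' i =1 cont v'' i) -> pos v' =1 pos v'' -> reach p v t' v''.
Proof.
move=> H ht hC hh T R; have [t1 [T1 [le r R1]]] := H T R.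
exists t1, T1; split=> //; first exact: leq_trans le ht.
exact: tapes_rep_ext hC hh R1.
Qed.

(** A view assigns data to every index, but only the tapes up to m exist, so agreement on those is
    enough. *)
Lemma reach_weak_in p v t v' v'' : reach p v t v' ->
  (forall i, i <= m -> cont v' i =1 cont v'' i /\ pos v' i = pos v'' i) -> reach p v t v''.
Proof.
move=> H hv T R; have [t1 [T1 [le r R1]]] := H T R; exists t1, T1; split=> // i.
have [hC hp] := hv i (leq_ord i); case: (R1 i) => l r1; rewrite -hp.
by split=> [|j]; rewrite -?hC // l; congr rev; apply: eq_mkseq.
Qed.

Lemma reach_le p v t t' v' : reach p v t v' -> t <= t' -> reach p v t' v'.
Proof. by move=> H ht; apply: reach_weak H ht _ _. Qed.

Lemma rep_read T v i : tapes_rep T v -> i <= m ->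
  read_all T (inord i) = cont v i (pos v i).
Proof.
move=> R hi; have := R (inord i); rewrite inordK ?ltnS // => /tape_rep_read.
by rewrite ffunE.
Qed.

(** Writing back the symbol read may list a blank that was implicit: the tape changes as a data
    structure, but not the view it represents. *)
Lemma rep_keep T v : tapes_rep T v -> tapes_rep (write_all T (keep (read_all T))) v.
Proof.
move=> R i; rewrite write_keep ffunE (tape_rep_read (R i)).
have := @tape_rep_write _ _ _ (cont v i (pos v i)) MoveN (R i).
case=> // l r; split; last by move=> j; rewrite r upd_id.
by rewrite l; congr rev; apply: eq_mkseq => j; rewrite upd_id.
Qed.

Lemma reach_act i g v c mv : i <= m ->
  g (cont v i (pos v i)) = (c, mv) -> (mv = MoveL -> 0 < pos v i) ->
  reach (Act i g) v 1 (View (upd (cont v) i (upd (cont v i) (pos v i) c))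
                            (upd (pos v) i (shift mv (pos v i)))).
Proof.
move=> hi E hmv T R; exists 1.
exists (write_all T (act_on i g (read_all T))); split=> //; first exact: runs_exit.
move=> j; rewrite !ffunE /= /upd (tape_rep_read (R j)).
case: eqP => [ji|_].
  rewrite ji E; have := R j; rewrite ji => Rj.
  exact: tape_rep_write.
have := @tape_rep_write _ _ _ (cont v j (pos v j)) MoveN (R j).
case=> // l r; split; last by move=> q; rewrite r upd_id.
by rewrite l; congr rev; apply: eq_mkseq => q; rewrite upd_id.
Qed.

Lemma reach_seq p q v t v' t' v'' :
  reach p v t v' -> reach q v' t' v'' -> reach (TSeq p q) v (t + t') v''.
Proof.
move=> H1 H2 T R; have [t1 [T1 [le1 r1 R1]]] := H1 T R.
have [t2 [T2 [le2 r2 R2]]] := H2 _ R1.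
by exists (t1 + t2), T2; split=> //; [apply: leq_add|apply: runs_seq r1 r2].
Qed.

Lemma reach_if i j b p q v t v' : i <= m -> j <= m ->
  (if b (cont v i (pos v i)) (cont v j (pos v j))
   then reach p v t v' else reach q v t v') ->
  reach (TIf i j b p q) v t.+1 v'.
Proof.
move=> hi hj H T R; case E: (b _ _) H => H.
  have [t1 [T1 [le1 r1 R1]]] := H _ (rep_keep R).
  by exists t1.+1, T1; split=> //; apply: runs_if; rewrite !(rep_read R) // E.
have [t1 [T1 [le1 r1 R1]]] := H _ (rep_keep R).
by exists t1.+1, T1; split=> //; apply: runs_if; rewrite !(rep_read R) // E.
Qed.

Lemma reach_while0 i j b p v : i <= m -> j <= m ->
  ~~ b (cont v i (pos v i)) (cont v j (pos v j)) -> reach (TWhile i j b p) v 1 v.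
Proof.
move=> hi hj H T R; exists 1, (write_all T (keep (read_all T))); split=> //.
  by apply: runs_while0; rewrite !(rep_read R).
exact: rep_keep.
Qed.

Lemma reach_whileS i j (b : mcell -> mcell -> bool) p v t v' t' v'' : i <= m -> j <= m ->
  b (cont v i (pos v i)) (cont v j (pos v j)) ->
  reach p v t v' -> reach (TWhile i j b p) v' t' v'' ->
  reach (TWhile i j b p) v (t + t').+1 v''.
Proof.
move=> hi hj H H1 H2 T R; have [t1 [T1 [le1 r1 R1]]] := H1 _ (rep_keep R).
have [t2 [T2 [le2 r2 R2]]] := H2 _ R1.
exists (t1 + t2).+1, T2; split=> //; first by rewrite ltnS leq_add.
by apply: runs_whileS r1 r2; rewrite !(rep_read R).
Qed.

(** The caller supplies the view after each round. A round costs t steps and one test, and the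
    failing test costs one more step. *)
Lemma reach_while i j (b : mcell -> mcell -> bool) p (v : nat -> view) n t : i <= m -> j <= m ->
  (forall x, x < n -> b (cont (v x) i (pos (v x) i)) (cont (v x) j (pos (v x) j))) ->
  (forall x, x < n -> reach p (v x) t (v x.+1)) ->
  ~~ b (cont (v n) i (pos (v n) i)) (cont (v n) j (pos (v n) j)) ->
  reach (TWhile i j b p) (v 0) (n * t.+1 + 1) (v n).
Proof.
move=> hi hj; elim: n v => [|n IH] v hb hp hn; first exact: reach_while0.
apply: (@reach_le _ _ (t + (n * t.+1 + 1)).+1); last by lia.
apply: (@reach_whileS _ _ _ _ _ _ (v 1)) => //; [exact: hb|exact: hp|].
by apply: (IH (fun x => v x.+1)) => // x hx; [apply: hb|apply: hp].
Qed.

End Machine.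

(** * A register language *)

(** A cell with both flags down is a blank, so the untouched part of a tape already represents
    cleared entries. *)
Definition mk (h b : bool) : mcell := if h || b then Some (inr (h, b)) else None.
Definition is_home (c : mcell) := if c is Some (inr (h, _)) then h else false.
Definition is_marked (c : mcell) := if c is Some (inr (_, b)) then b else false.
Definition is_bit (c : mcell) := if c is Some (inl _) then true else false.
Definition is_one (c : mcell) := if c is Some (inl b) then b else false.

Lemma is_home_mk h b : is_home (mk h b) = h. Proof. by case: h b => [] []. Qed.
Lemma is_marked_mk h b : is_marked (mk h b) = b. Proof. by case: h b => [] []. Qed.

(* Tape 0 holds input and output, tape 1 is scratch, the end mark of tape 2
   is at position n, tapes 3 and 4 hold the arrays, and the other tapes are
   registers whose value is the head position: 5-7 are counters, 8-10 loop
   variables bounded by k, and 11-17 loop variables bounded by n. *)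
Local Notation last_tape := 17 (only parsing).

Local Notation reachL := (@reach last_tape).

Definition stay x := Act x (fun c => (c, MoveN)).
Definition mvL x := Act x (fun c => (c, MoveL)).
Definition mvR x := Act x (fun c => (c, MoveR)).
Definition while_away x := TWhile x x (fun c _ => ~~ is_home c).
Definition rewind x := while_away x (mvL x).
Definition transfer x y := while_away x (TSeq (mvL x) (mvR y)).

Definition homed (v : view) x := forall q, is_home (cont v x q) = (q == 0).

Lemma reach_stay x C h : x <= last_tape -> reachL (stay x) (View C h) 1 (View C h).
Proof.
move=> hx; apply: reach_weak (reach_act (v := View C h) hx (erefl _) _) _ _ _ => //= i.
  by rewrite /upd; case: eqP => // -> j; case: eqP => // ->.
by rewrite upd_id.
Qed.

Lemma reach_mvR x C h : x <= last_tape ->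
  reachL (mvR x) (View C h) 1 (View C (upd h x (h x).+1)).
Proof.
move=> hx; apply: reach_weak (reach_act (v := View C h) hx (erefl _) _) _ _ _ => //= i.
by rewrite /upd; case: eqP => // -> j; case: eqP => // ->.
Qed.

Lemma reach_mvL x C h : x <= last_tape -> 0 < h x ->
  reachL (mvL x) (View C h) 1 (View C (upd h x (h x).-1)).
Proof.
move=> hx hp; apply: reach_weak (reach_act (v := View C h) hx (erefl _) _) _ _ _ => //= i.
by rewrite /upd; case: eqP => // -> j; case: eqP => // ->.
Qed.

(* The family [g] describes the head positions after each round. *)
Lemma reach_while_away x p C (g : nat -> nat -> nat) r t : x <= last_tape ->
  (forall q, is_home (C x q) = (q == 0)) -> (forall i, i <= r -> g i x = r - i) ->
  (forall i, i < r -> reachL p (View C (g i)) t (View C (g i.+1))) ->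
  reachL (while_away x p) (View C (g 0)) (r * t.+1 + 1) (View C (g r)).
Proof.
move=> hx hC hg hp.
apply: (@reach_while last_tape x x _ p (fun i => View C (g i))) => //= [i hi|].
  by rewrite hC hg; lia.
by rewrite hC hg //; lia.
Qed.

Lemma reach_rewind x C h : x <= last_tape -> homed (View C h) x ->
  reachL (rewind x) (View C h) (h x * 2 + 1) (View C (upd h x 0)).
Proof.
move=> hx hC; pose g i := upd h x (h x - i).
apply: (@reach_weak _ _ _ (h x * 2 + 1) (View C (g (h x)))) => //=; last first.
  by move=> i; rewrite /g subnn.
have H : reachL (while_away x (mvL x)) (View C (g 0)) (h x * 2 + 1) (View C (g (h x))).
  apply: reach_while_away => // [i hi|i hi]; first by rewrite /g upd_same.
  apply: reach_weak (reach_mvL hx _) _ _ _ => //=; rewrite /g ?upd_same; first lia.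
  by move=> j; rewrite /upd; case: eqP => // _; lia.
move=> T R; apply: H; apply: tapes_rep_ext R => //= i.
by rewrite /g subn0 upd_id.
Qed.

Lemma reach_pre p v0 v t v' : (forall i, cont v0 i =1 cont v i) -> pos v0 =1 pos v ->
  reachL p v t v' -> reachL p v0 t v'.
Proof. by move=> hC hh H T R; apply: H; apply: tapes_rep_ext R. Qed.

Ltac upd_tac := rewrite /upd; repeat (case: eqP => ?); try subst; try lia; try by [].

Lemma reach_transfer x y C h : x <= last_tape -> y <= last_tape -> x != y ->
  homed (View C h) x ->
  reachL (transfer x y) (View C h) (h x * 3 + 1) (View C (upd (upd h x 0) y (h y + h x))).
Proof.
move=> hx hy nxy hC; pose g i := upd (upd h x (h x - i)) y (h y + i).
apply: (@reach_pre _ _ (View C (g 0))) => //= [i|].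
  by rewrite /g /upd; repeat case: eqP => [->|?] //; lia.
apply: (@reach_weak _ _ _ (h x * 3 + 1) (View C (g (h x)))) => //=; last first.
  by move=> i; rewrite /g subnn.
apply: reach_while_away => // [i hi|i hi].
  by rewrite /g /upd eqxx (negPf nxy).
apply: (@reach_weak _ _ _ (1 + 1)).
- apply: reach_seq; first by apply: reach_mvL => //; rewrite /g /upd eqxx (negPf nxy); lia.
  exact: reach_mvR.
- by [].
- by [].
- by move=> j /=; rewrite /g; move/eqP: nxy; upd_tac.
Qed.

(** * Addressing the arrays *)

Section Params.
Variables n k : nat.

Definition bnd (x : nat) : option nat :=
  if (x == 2) || (10 < x) then Some n else if 7 < x then Some k else None.
Definition bound x := odflt 0 (bnd x).

(** Tape 2 is a yardstick: its head walks to the end mark at n with head [a] alongside, and one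
    extra move completes the row length n.+1. *)
Definition stride a :=
  TSeq (TWhile 2 2 (fun c _ => ~~ is_marked c) (TSeq (mvR 2) (mvR a)))
       (TSeq (mvR a) (rewind 2)).

(** Counting a register down destroys it, so its value is collected on tape 1 and then transferred
    back. Each unit of x is worth one stride of head [a], each unit of y one move. *)
Definition seek a x y :=
  TSeq (while_away x (TSeq (mvL x) (TSeq (mvR 1) (stride a))))
  (TSeq (transfer 1 x)
  (TSeq (while_away y (TSeq (mvL y) (TSeq (mvR 1) (mvR a))))
        (transfer 1 y))).

Definition strideT := n * 3 + 1 + (1 + (n * 2 + 1)).

Lemma reach_stride a C h : a <= last_tape -> a != 2 -> homed (View C h) 2 ->
  (forall q, is_marked (C 2 q) = (q == n)) -> h 2 = 0 ->
  reachL (stride a) (View C h) strideT (View C (upd h a (h a + n.+1))).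
Proof.
move=> ha na hC hm h0; pose g i := upd (upd h 2 i) a (h a + i).
have g2 i : g i 2 = i by rewrite /g /upd eq_sym (negPf na).
have ga i : g i a = h a + i by rewrite /g /upd eqxx.
apply: (@reach_pre _ _ (View C (g 0))) => //= [i|].
  by rewrite /g; upd_tac.
apply: (@reach_weak _ _ _ strideT (View C (upd (upd (g n) a (h a + n).+1) 2 0))) => //=; last first.
  by move=> i; rewrite /g; move/eqP: na; upd_tac.
apply: reach_seq.
  apply: (@reach_while _ _ _ _ _ (fun i => View C (g i)) n 2) => //= [i hi|i hi|].
  - by rewrite hm g2; lia.
  - apply: (@reach_weak _ _ _ (1 + 1)); first by apply: reach_seq; apply: reach_mvR.
    + by [].
    + by [].
    + by move=> j /=; rewrite /g; move/eqP: na; upd_tac.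
  - by rewrite hm g2 eqxx.
apply: reach_seq.
  by apply: (reach_mvR (h := g n)).
rewrite ga; have g2' : upd (g n) a (h a + n).+1 2 = n.
  by rewrite /upd eq_sym (negPf na) -/(upd _ _ _) -/(g n) g2.
apply: reach_le (reach_rewind _ _) _ => //.
by rewrite g2'.
Qed.

Definition seekT x y := x * (1 + (1 + strideT)).+1 + 1 + (x * 3 + 1 + (y * 4 + 1 + (y * 3 + 1))).

Lemma reach_seek a x y C h : a \in [:: 3; 4] -> 4 < x <= last_tape -> 4 < y <= last_tape ->
  (forall i, 0 < i -> homed (View C h) i) ->
  (forall q, is_marked (C 2 q) = (q == n)) -> h 1 = 0 -> h 2 = 0 -> h a = 0 ->
  reachL (seek a x y) (View C h) (seekT (h x) (h y))
    (View C (upd h a (h x * n.+1 + h y))).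
Proof.
move=> ha hx hy hC hm h1 h2 h3.
have la : a <= last_tape by move: ha; rewrite !inE => /orP[]/eqP->.
have [xa ya] : x != a /\ y != a by move: ha; rewrite !inE => /orP[]/eqP->; lia.
have [a1 a2] : a != 1 /\ a != 2 by move: ha; rewrite !inE => /orP[]/eqP->.
pose g1 i := upd (upd (upd h x (h x - i)) 1 i) a (i * n.+1).
have r1 : reachL (while_away x (TSeq (mvL x) (TSeq (mvR 1) (stride a))))
    (View C (g1 0)) (h x * (1 + (1 + strideT)).+1 + 1) (View C (g1 (h x))).
  apply: reach_while_away; [lia|apply: (hC x); lia|move=> i hi|move=> i hi].
    by rewrite /g1; upd_tac.
  apply: (@reach_weak _ _ _ (1 + (1 + strideT))).
  - apply: reach_seq; first by apply: reach_mvL; [lia|rewrite /g1; upd_tac].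
    apply: reach_seq; first exact: reach_mvR.
    by apply: reach_stride => //; [apply: hC|rewrite /g1; upd_tac].
  - by [].
  - by [].
  - by move=> j /=; rewrite /g1; upd_tac.
apply: (@reach_pre _ _ (View C (g1 0))) => //= [i|].
  by rewrite /g1; upd_tac.
apply: reach_seq r1 _.
pose h' := upd h a (h x * n.+1).
apply: reach_seq.
  apply: (@reach_weak _ _ _ (h x * 3 + 1) _ _ (View C h')).
  - apply: reach_le (reach_transfer _ _ _ _) _ => //; try lia; first exact: hC.
    by rewrite /g1; upd_tac.
  - by [].
  - by [].
  - by move=> j /=; rewrite /g1 /h'; upd_tac.
pose g2 i := upd (upd (upd h' y (h y - i)) 1 i) a (h x * n.+1 + i).
have r2 : reachL (while_away y (TSeq (mvL y) (TSeq (mvR 1) (mvR a))))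
    (View C (g2 0)) (h y * 4 + 1) (View C (g2 (h y))).
  apply: reach_while_away; [lia|apply: (hC y); lia|move=> i hi|move=> i hi].
    by rewrite /g2; upd_tac.
  apply: (@reach_weak _ _ _ (1 + (1 + 1))).
  - apply: reach_seq; first by apply: reach_mvL; [lia|rewrite /g2; upd_tac].
    by apply: reach_seq; apply: reach_mvR.
  - by [].
  - by [].
  - by move=> j /=; rewrite /g2; upd_tac.
apply: (@reach_pre _ _ (View C (g2 0))) => //= [i|].
  by rewrite /g2 /h'; upd_tac.
apply: reach_seq r2 _.
apply: (@reach_weak _ _ _ (h y * 3 + 1)).
- apply: reach_le (reach_transfer _ _ _ _) _ => //; try lia; first exact: hC.
  by rewrite /g2; upd_tac.
- by [].
- by [].
- by move=> j /=; rewrite /g2 /h'; upd_tac.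
Qed.

(** * Syntax and semantics of the register language *)

Record state := State {
  reg : nat -> nat;
  arr : nat -> nat -> nat -> bool;
  inp : seq bool;
  out : seq bool }.

Inductive cmd :=
| Skip
| Zero of nat
| Inc of nat
| For of nat & cmd
| IfLt of nat & nat & cmd & cmd
| IfArr of nat & nat & nat & cmd & cmd
| SetArr of nat & nat & nat & bool
| IfIn of cmd & cmd
| Emit of bool
| Sq of cmd & cmd.

Definition setr s x v := State (upd (reg s) x v) (arr s) (inp s) (out s).
Definition incr s x := setr s x (reg s x).+1.
Definition seta s a x y b :=
  State (reg s) (upd (arr s) a (upd (arr s a) x (upd (arr s a x) y b))) (inp s) (out s).
(** Input and output share one tape and one head. Reading blanks the cell and so cuts off earlier
    output, hence the empty list; [emit] overwrites the next unread bit, hence its [behead]. *)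
Definition getin s := State (reg s) (arr s) (behead (inp s)) [::].
Definition emit s b := State (reg s) (arr s) (behead (inp s)) (rcons (out s) b).

Fixpoint exec (c : cmd) (s : state) : state :=
  match c with
  | Skip => s
  | Zero x => setr s x 0
  | Inc x => incr s x
  | For x c => iter (bound x) (fun s => incr (exec c s) x) (setr s x 0)
  | IfLt x y c d => if reg s x < reg s y then exec c s else exec d s
  | IfArr a x y c d => if arr s a (reg s x) (reg s y) then exec c s else exec d s
  | SetArr a x y b => seta s a (reg s x) (reg s y) b
  | IfIn c d => if head false (inp s) then exec c (getin s) else exec d (getin s)
  | Emit b => emit s b
  | Sq c d => exec d (exec c s)
  end.

Fixpoint assigned x c :=
  match c with
  | Zero y | Inc y => x == y
  | For y c => (x == y) || assigned x c
  | IfLt _ _ c d | IfArr _ _ _ c d | IfIn c d | Sq c d => assigned x c || assigned x d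
  | _ => false
  end.

(** Array indices must be variables bounded by n, so that an address determines its row and column.
    The operands of [IfLt] must differ because their heads are moved separately. *)
Fixpoint wf c :=
  match c with
  | Zero y | Inc y => 4 < y < 8
  | For y c => [&& 7 < y <= last_tape, ~~ assigned y c & wf c]
  | IfLt x y c d => [&& 4 < x <= last_tape, 4 < y <= last_tape, x != y, wf c & wf d]
  | IfArr a x y c d => [&& a \in [:: 3; 4], 10 < x <= last_tape, 10 < y <= last_tape, wf c & wf d]
  | SetArr a x y b => [&& a \in [:: 3; 4], 10 < x <= last_tape & 10 < y <= last_tape]
  | IfIn c d | Sq c d => wf c && wf d
  | _ => true
  end.

Lemma exec_frame x c s : ~~ assigned x c -> reg (exec c s) x = reg s x.
Proof.
elim: c s => //= [y|y|y c IH|y z c IHc d IHd|a y z c IHc d IHd|c IHc d IHd|c IHc d IHd] s.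
- by move=> /negPf nx; rewrite /upd nx.
- by move=> /negPf nx; rewrite /upd nx.
- rewrite negb_or => /andP[/negPf nx na]; have -> : reg s x = reg (setr s y 0) x.
    by rewrite /= /upd nx.
  by elim: (bound y) => // b E; rewrite -E /= {1}/upd nx IH.
- by rewrite negb_or => /andP[? ?]; case: ifP => _; auto.
- by rewrite negb_or => /andP[? ?]; case: ifP => _; auto.
- by rewrite negb_or => /andP[? ?]; case: ifP => _; [rewrite IHc|rewrite IHd].
- by rewrite negb_or => /andP[? ?]; rewrite IHd // IHc.
Qed.

(** For [IfLt], both registers are counted down in step until one is 0, with the number of rounds on
    tape 1; then x < y exactly when y is still positive. The restoring loop [r] stands in both
    branches because the test has to precede it. *)
Fixpoint compile c :=
  match c with
  | Skip => stay 1
  | Zero x => rewind x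
  | Inc x => mvR x
  | For x c => TSeq (rewind x) (TWhile x x (fun c _ => ~~ is_marked c) (TSeq (compile c) (mvR x)))
  | IfLt x y c d =>
      let r := while_away 1 (TSeq (mvL 1) (TSeq (mvR x) (mvR y))) in
      TSeq (TWhile x y (fun a b => ~~ is_home a && ~~ is_home b)
              (TSeq (mvL x) (TSeq (mvL y) (mvR 1))))
           (TIf y y (fun b _ => ~~ is_home b) (TSeq r (compile c)) (TSeq r (compile d)))
  | IfArr a x y c d =>
      TSeq (seek a x y)
           (TIf a a (fun b _ => is_marked b) (TSeq (rewind a) (compile c)) (TSeq (rewind a) (compile d)))
  | SetArr a x y b =>
      TSeq (seek a x y) (TSeq (Act a (fun c => (mk (is_home c) b, MoveN))) (rewind a))
  | IfIn c d =>
      let r := Act 0 (fun _ => (None, MoveR)) in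
      TIf 0 0 (fun b _ => is_one b) (TSeq r (compile c)) (TSeq r (compile d))
  | Emit b => Act 0 (fun _ => (Some (inl b), MoveR))
  | Sq c d => TSeq (compile c) (compile d)
  end.

(* Rows have length n.+1 because a loop variable bounded by n ends with value n. *)
Definition content s i : nat -> mcell :=
  if i \in [:: 3; 4] then fun q => mk (q == 0) (arr s i (q %/ n.+1) (q %% n.+1))
  else fun q => mk (q == 0) (bnd i == Some q).

(** Here q is where the output begins. The blank before it stops the final walk back to the left,
    and the unread input starts at the head and is followed by blanks only. *)
Definition io_rep (inp out : seq bool) (f : nat -> mcell) (p : nat) :=
  exists q, [/\ 0 < q, f q.-1 = None, p = q + size out,
    forall i, i < size out -> f (q + i) = Some (inl (nth false out i)) &
    forall i, f (p + i) = nth None [seq Some (inl b) | b <- inp] i].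

Record state_rep (s : state) (v : view) : Prop := Repr {
  repr_cont : forall i, 0 < i -> cont v i =1 content s i;
  repr_pos : forall i, 0 < i -> pos v i = if i < 5 then 0 else reg s i;
  repr_io : io_rep (inp s) (out s) (cont v 0) (pos v 0);
  repr_bnd : forall i, 7 < i -> reg s i <= bound i }.

(** * Simulation of commands by compiled programs *)

Definition sim p s t s' :=
  forall v, state_rep s v -> exists v', reachL p v t v' /\ state_rep s' v'.

Lemma sim_seq p q s t s' t' s'' : sim p s t s' -> sim q s' t' s'' ->
  sim (TSeq p q) s (t + t') s''.
Proof.
move=> H1 H2 v R; have [v1 [r1 R1]] := H1 v R; have [v2 [r2 R2]] := H2 _ R1.
by exists v2; split=> //; apply: reach_seq r1 r2.
Qed.

Lemma sim_le p s t t' s' : sim p s t s' -> t <= t' -> sim p s t' s'.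
Proof.
move=> H ht v R; have [v' [r R']] := H v R; exists v'; split=> //.
exact: reach_le r ht.
Qed.

Lemma repr_homed s v i : state_rep s v -> 0 < i -> homed v i.
Proof.
by move=> R hi q; rewrite (repr_cont R) // /content; case: ifP => _; rewrite is_home_mk.
Qed.

Lemma repr_marked s v i : state_rep s v -> 0 < i -> i \notin [:: 3; 4] ->
  forall q, is_marked (cont v i q) = (bnd i == Some q).
Proof.
by move=> R hi ni q; rewrite (repr_cont R) // /content (negPf ni) is_marked_mk.
Qed.

Lemma repr_reg s v x : state_rep s v -> 4 < x -> pos v x = reg s x.
Proof.
move=> R hx; rewrite (repr_pos R (ltn_trans (isT : 0 < 4) hx)).
by rewrite ltnNge hx.
Qed.

Lemma repr_setr s v x w : state_rep s v -> 4 < x -> (7 < x -> w <= bound x) ->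
  state_rep (setr s x w) (View (cont v) (upd (pos v) x w)).
Proof.
case: v => C h [h1 h2 h3 h4] hx hw; split=> //= [i hi||i hi].
- by rewrite /upd (h2 i hi : h i = _); case: eqP => // ->; rewrite ltnNge hx.
- by have -> : upd h x w 0 = h 0 by rewrite /upd; case: eqP => // E; rewrite -E in hx.
- by rewrite /upd; case: eqP => [E|_]; [rewrite -E in hw *; apply: hw|apply: h4].
Qed.

Lemma sim_rewind x s M : 4 < x <= last_tape -> reg s x <= M ->
  sim (rewind x) s (M * 2 + 1) (setr s x 0).
Proof.
case/andP=> hx hx' hM [C h] R; exists (View C (upd h x 0)); split.
  apply: reach_le (reach_rewind _ _) _ => //; first by apply: (repr_homed R); lia.
  by have /= -> := repr_reg R hx; lia.
exact: (repr_setr R).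
Qed.

Lemma sim_inc x s : 4 < x <= last_tape -> (7 < x -> reg s x < bound x) ->
  sim (mvR x) s 1 (incr s x).
Proof.
case/andP=> hx hx' hM [C h] R; exists (View C (upd h x (h x).+1)); split.
  exact: reach_mvR.
have /= -> := repr_reg R hx.
exact: (repr_setr R).
Qed.

(** The loop is described from the middle, with variable at i and r rounds left, so that induction
    on r goes through. *)
Lemma sim_while x c s (F : state -> state) T r i : 7 < x <= last_tape ->
  reg s x = i -> i + r = bound x ->
  (forall j, j < r -> sim (compile c) (iter j (fun s => incr (F s) x) s) T
     (F (iter j (fun s => incr (F s) x) s))) ->
  (forall s, reg (F s) x = reg s x) ->
  sim (TWhile x x (fun c _ => ~~ is_marked c) (TSeq (compile c) (mvR x))) s
    (r * (T + 1).+1 + 1) (iter r (fun s => incr (F s) x) s).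
Proof.
move=> hx hi hr hc hF; elim: r s i hi hr hc => [|r IH] s i hi hr hc v R.
  exists v; split=> //; apply: reach_while0; try lia.
  rewrite (repr_marked R) ?inE; try lia.
  rewrite (repr_reg R); last by lia.
  rewrite hi negbK; have -> : i = bound x by lia.
  by case/andP: hx => hx _; rewrite /bound /bnd hx; case: ifP => /=.
have [v1 [r1 R1]] := hc 0 isT v R.
have [v2 [r2 R2]] : exists v', reachL (mvR x) v1 1 v' /\ state_rep (incr (F s) x) v'.
  by apply: sim_inc R1; [lia|rewrite hF hi; lia].
have [||j hj|v3 [r3 R3]] := IH (incr (F s) x) i.+1 _ _ _ _ R2.
- by rewrite /= upd_same hF hi.
- by lia.
- by have := hc j.+1 hj; rewrite !iterSr.
exists v3; split; last by rewrite iterSr.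
apply: (@reach_le _ _ _ ((T + 1) + (r * (T + 1).+1 + 1)).+1); last by lia.
apply: reach_whileS (reach_seq r1 r2) r3; try lia.
rewrite (repr_marked R) ?inE; try lia.
rewrite (repr_reg R); last by lia.
rewrite hi; have : i != bound x by lia.
by rewrite /bound; case: (bnd x) => //= b; apply: contra => /eqP[->].
Qed.

Definition seekM M :=
  M * (1 + (1 + (M * 3 + 1 + (1 + (M * 2 + 1))))).+1 + 1 + (M * 3 + 1 + (M * 4 + 1 + (M * 3 + 1))).
Definition homeM M := (M * M.+1 + M) * 2 + 1.

(** M bounds n and k and all registers during the run. Both branches of a conditional are charged,
    so the bound consists of sums and products only. *)
Fixpoint cost c M :=
  match c with
  | Zero _ => M * 2 + 1
  | For _ c => M * 2 + 1 + (M * (cost c M + 1).+1 + 1)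
  | IfLt _ _ c d => M * 4 + 1 + (M * 4 + 1 + (cost c M + cost d M)).+1
  | IfArr _ _ _ c d => seekM M + (homeM M + (cost c M + cost d M)).+1
  | SetArr _ _ _ _ => seekM M + (1 + homeM M)
  | IfIn c d => (1 + (cost c M + cost d M)).+1
  | Sq c d => cost c M + cost d M
  | _ => 1
  end.

(** One function bounds both the increase of the registers and the length of the output. *)
Fixpoint grow c N :=
  match c with
  | Inc _ | Emit _ => 1
  | For _ c => N * grow c N
  | IfLt _ _ c d | IfArr _ _ _ c d | IfIn c d | Sq c d => grow c N + grow d N
  | _ => 0
  end.

Lemma seekM_mono M M' : M <= M' -> seekM M <= seekM M'.
Proof. by move=> h; rewrite /seekM; do ![apply: leq_add|apply: leq_mul|rewrite ltnS] => //; lia. Qed.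

Lemma homeM_mono M M' : M <= M' -> homeM M <= homeM M'.
Proof. by move=> h; rewrite /homeM; do ![apply: leq_add|apply: leq_mul] => //; lia. Qed.

Lemma cost_mono c M M' : M <= M' -> cost c M <= cost c M'.
Proof.
move=> h; elim: c => //= [_|x c IH|x y c IHc d IHd|a x y c IHc d IHd|a x y b|c IHc d IHd|c IHc d IHd].
- by lia.
- have : M * (cost c M + 1).+1 <= M' * (cost c M' + 1).+1 by apply: leq_mul => //; lia.
  by lia.
- by lia.
- by have := seekM_mono h; have := homeM_mono h; lia.
- by have := seekM_mono h; have := homeM_mono h; lia.
- by lia.
- by lia.
Qed.

Lemma sim_iflt x y p q s t s' M :
  4 < x <= last_tape -> 4 < y <= last_tape -> x != y -> reg s x <= M ->
  (if reg s x < reg s y then sim p s t s' else sim q s t s') ->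
  let r := while_away 1 (TSeq (mvL 1) (TSeq (mvR x) (mvR y))) in
  sim (TSeq (TWhile x y (fun a b => ~~ is_home a && ~~ is_home b)
              (TSeq (mvL x) (TSeq (mvL y) (mvR 1))))
           (TIf y y (fun b _ => ~~ is_home b) (TSeq r p) (TSeq r q)))
    s (M * 4 + 1 + (M * 4 + 1 + t).+1) s'.
Proof.
move=> hx hy nxy hM H r [C h] R.
have rx : h x = reg s x by apply: (repr_reg R); lia.
have ry : h y = reg s y by apply: (repr_reg R); lia.
have h1 : h 1 = 0 by have := repr_pos R (isT : 0 < 1).
have hC i : 0 < i -> homed (View C h) i by apply: repr_homed R.
pose mi := minn (h x) (h y).
pose g i := upd (upd (upd h x (h x - i)) y (h y - i)) 1 i.
have r1 : reachL (TWhile x y (fun a b => ~~ is_home a && ~~ is_home b)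
      (TSeq (mvL x) (TSeq (mvL y) (mvR 1)))) (View C (g 0)) (mi * 4 + 1) (View C (g mi)).
  have gx i : g i x = h x - i by rewrite /g; upd_tac.
  have gy i : g i y = h y - i by rewrite /g; upd_tac.
  have ex j : is_home (C x j) = (j == 0) by apply: hC; lia.
  have ey j : is_home (C y j) = (j == 0) by apply: hC; lia.
  apply: (@reach_while _ x y _ _ (fun i => View C (g i)) mi 3) => /= [||i hi|i hi|]; rewrite ?ex ?ey ?gx ?gy; try lia.
  apply: (@reach_weak _ _ _ (1 + (1 + 1))).
  - apply: reach_seq; first by apply: reach_mvL; rewrite ?gx; lia.
    apply: reach_seq; first by apply: reach_mvL; [lia|rewrite /g; upd_tac].
    exact: reach_mvR.
  - by [].
  - by [].
  - by move=> j /=; rewrite /g; upd_tac.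
(* Positions during the restoring loop, which moves both heads forward by the amount stored on tape
   1. *)
pose g' i := upd (upd (upd h x (h x - mi + i)) y (h y - mi + i)) 1 (mi - i).
have r2 : reachL r (View C (g' 0)) (mi * 4 + 1) (View C (g' mi)).
  apply: reach_while_away; [lia|exact: hC|move=> i hi|move=> i hi].
    by rewrite /g'; upd_tac.
  apply: (@reach_weak _ _ _ (1 + (1 + 1))).
  - apply: reach_seq; first by apply: reach_mvL; [lia|rewrite /g'; upd_tac].
    by apply: reach_seq; apply: reach_mvR; lia.
  - by [].
  - by [].
  - by move=> j /=; rewrite /g'; upd_tac.
have {}r2 : reachL r (View C (g mi)) (mi * 4 + 1) (View C h).
  apply: reach_pre (reach_weak r2 _ _ _) => //= i; first by rewrite /g /g'; upd_tac.
  by rewrite /g'; upd_tac.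
(* After min(x, y) rounds the register y is exhausted exactly when y <= x. *)
have hy0 : is_home (C y (g mi y)) = ~~ (reg s x < reg s y).
  have -> : is_home (C y (g mi y)) = (g mi y == 0) by apply: hC; lia.
  have -> : g mi y = h y - mi by rewrite /g; upd_tac.
  lia.
have {}r1 : reachL (TWhile x y (fun a b => ~~ is_home a && ~~ is_home b)
      (TSeq (mvL x) (TSeq (mvL y) (mvR 1)))) (View C h) (mi * 4 + 1) (View C (g mi)).
  by apply: reach_pre r1 => //= i; rewrite /g; upd_tac.
have lt : mi * 4 + 1 <= M * 4 + 1 by lia.
have fin pp v' : reachL pp (View C h) t v' ->
    reachL (TSeq r pp) (View C (g mi)) (M * 4 + 1 + t) v'.
  by move=> Hp; apply: reach_seq Hp; apply: reach_le r2 lt.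
case E: (reg s x < reg s y) H => H; have [v' [rr R']] := H _ R; exists v'; split=> //;
  apply: (reach_seq (reach_le r1 lt)); apply: reach_if; rewrite /= ?hy0 ?E /=; try lia;
  exact: fin.
Qed.

(** Both indices are at most n, hence below the row length, so division of the address by n.+1
    recovers them. *)
Lemma sim_seek a x y s v M : a \in [:: 3; 4] -> 10 < x <= last_tape -> 10 < y <= last_tape ->
  n <= M -> state_rep s v ->
  let q := reg s x * n.+1 + reg s y in
  [/\ reachL (seek a x y) v (seekM M) (View (cont v) (upd (pos v) a q)),
      reachL (rewind a) (View (cont v) (upd (pos v) a q)) (homeM M) v,
      q %/ n.+1 = reg s x & q %% n.+1 = reg s y].
Proof.
case: v => C h ha hx hy hM R q.
have rx : h x = reg s x by apply: (repr_reg R); lia.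
have ry : h y = reg s y by apply: (repr_reg R); lia.
have bx z : 10 < z -> reg s z <= n.
  move=> hz; have := repr_bnd R (ltn_trans (isT : 7 < 10) hz).
  by rewrite /bound /bnd hz orbT.
have [xn yn] : reg s x <= n /\ reg s y <= n by split; apply: bx; lia.
have h0 i : 0 < i < 5 -> h i = 0.
  by case/andP=> i0 i5; have := repr_pos R i0; rewrite i5.
have a5 : 0 < a < 5 by move: ha; rewrite !inE => /orP[]/eqP->.
have la : a <= last_tape by lia.
have hC i : 0 < i -> homed (View C h) i by apply: repr_homed R.
split.
- rewrite /q -rx -ry; apply: reach_le.
    apply: reach_seek => //; rewrite ?h0 //; try lia.
    by move=> w; rewrite (repr_marked R) // eq_sym.
  rewrite /seekT /strideT /seekM rx ry.
  by do ![apply: leq_add|apply: leq_mul|rewrite ltnS] => //; lia.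
- apply: reach_weak; first by apply: reach_rewind => //; apply: hC; lia.
  + rewrite upd_same /homeM /q leq_add2r leq_mul2r; apply: leq_add; last by lia.
    by apply: leq_mul; lia.
  + by [].
  + by move=> i; have := h0 _ a5; rewrite /=; upd_tac.
- by rewrite /q divnMDl // divn_small ?addn0 // ltnS.
- by rewrite /q modnMDl modn_small // ltnS.
Qed.

Lemma sim_ifarr a x y p q s t s' M :
  a \in [:: 3; 4] -> 10 < x <= last_tape -> 10 < y <= last_tape -> n <= M ->
  (if arr s a (reg s x) (reg s y) then sim p s t s' else sim q s t s') ->
  sim (TSeq (seek a x y)
           (TIf a a (fun b _ => is_marked b) (TSeq (rewind a) p) (TSeq (rewind a) q)))
    s (seekM M + (homeM M + t).+1) s'.
Proof.
move=> ha hx hy hM H v R; have [r1 r2 dx dy] := sim_seek ha hx hy hM R.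
have la : 0 < a <= last_tape by move: ha; rewrite !inE => /orP[]/eqP->.
have E0 : is_marked (cont v a (reg s x * n.+1 + reg s y)) = arr s a (reg s x) (reg s y).
  by rewrite (repr_cont R) /content ?ha ?is_marked_mk ?dx ?dy //; lia.
case E: (arr s a _ _) H => H; have [v' [rr R']] := H _ R; exists v'; split=> //;
  apply: (reach_seq r1); apply: reach_if; rewrite /= ?upd_same ?E0 ?E; try lia;
  exact: reach_seq r2 rr.
Qed.

Lemma sim_setarr a x y b s M :
  a \in [:: 3; 4] -> 10 < x <= last_tape -> 10 < y <= last_tape -> n <= M ->
  sim (TSeq (seek a x y) (TSeq (Act a (fun c => (mk (is_home c) b, MoveN))) (rewind a)))
    s (seekM M + (1 + homeM M)) (seta s a (reg s x) (reg s y) b).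
Proof.
move=> ha hx hy hM v R; have [r1 _ dx dy] := sim_seek ha hx hy hM R.
set q := _ + _ in r1 dx dy.
have la : 0 < a <= last_tape by move: ha; rewrite !inE => /orP[]/eqP->.
pose v' := View (upd (cont v) a (upd (cont v a) q (mk (q == 0) b))) (pos v).
have R' : state_rep (seta s a (reg s x) (reg s y) b) v'.
  case: R => h1 h2 h3 h4; split=> //= [i hi w|].
    rewrite /content /= /upd; case: (i =P a) => [->|ia]; last by rewrite h1.
    rewrite ha; case: (w =P q) => [->|wq]; first by rewrite dx dy !eqxx.
    rewrite h1 ?/content ?ha //; last by lia.
    congr mk; case: eqP => [Ex|//]; case: eqP => [Ey|_]; last by rewrite Ex.
    by case: wq; rewrite (divn_eq w n.+1) Ex Ey.
  by rewrite /upd; case: eqP => // E; lia.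
(* The rewind runs on the tape after the write, so it is taken from the new state. *)
have [_ r2 _ _] := sim_seek ha hx hy hM R'; rewrite /= -/q in r2.
exists v'; split=> //; apply: (reach_seq r1); apply: reach_seq r2.
apply: reach_weak; first by apply: reach_act => //; lia.
- by [].
- move=> i w /=; rewrite !upd_same.
  by rewrite (_ : is_home _ = (q == 0)) //; apply: (repr_homed R); lia.
- by move=> i /=; rewrite upd_same /upd; case: eqP.
Qed.

Lemma repr_readin s C h : state_rep s (View C h) ->
  state_rep (getin s) (View (upd C 0 (upd (C 0) (h 0) None)) (upd h 0 (h 0).+1)).
Proof.
case=> h1 h2 [q [q0 fq pq fo fi]] h4; split=> //= [i hi|i hi|].
- by move=> w; rewrite /upd; case: eqP => [E|_]; [lia|apply: h1].
- by rewrite /upd; case: eqP => [E|_]; [lia|apply: h2].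
rewrite /= in pq fq fo fi.
exists (h 0).+1; split=> //=.
- by rewrite !upd_same.
- by rewrite upd_same addn0.
move=> i; rewrite !upd_same addSn -addnS /upd.
case: eqP => [E|_]; first lia.
by rewrite fi /=; case: (inp s) => [|b l] //=; rewrite nth_nil.
Qed.

Lemma repr_emit s b C h : state_rep s (View C h) ->
  state_rep (emit s b) (View (upd C 0 (upd (C 0) (h 0) (Some (inl b)))) (upd h 0 (h 0).+1)).
Proof.
case=> h1 h2 [q [q0 fq pq fo fi]] h4; split=> //= [i hi|i hi|].
- by move=> w; rewrite /upd; case: eqP => [E|_]; [lia|apply: h1].
- by rewrite /upd; case: eqP => [E|_]; [lia|apply: h2].
rewrite /= in pq fq fo fi.
exists q; rewrite size_rcons !upd_same; split=> //.
- by rewrite /upd; case: eqP => // E; lia.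
- by rewrite pq addnS.
- move=> i hi; rewrite nth_rcons /upd; case: (ltnP i (size (out s))) => hi'.
    by case: eqP => [E|_]; [lia|apply: fo].
  have -> : i = size (out s) by lia.
  by rewrite pq eqxx eqxx.
move=> i; rewrite addSn -addnS /upd.
case: eqP => [E|_]; first lia.
by rewrite fi /=; case: (inp s) => [|c l] //=; rewrite nth_nil.
Qed.

Lemma sim_ifin p q s t s' :
  (if head false (inp s) then sim p (getin s) t s' else sim q (getin s) t s') ->
  let r := Act 0 (fun _ => (None, MoveR)) in
  sim (TIf 0 0 (fun b _ => is_one b) (TSeq r p) (TSeq r q)) s (1 + t).+1 s'.
Proof.
move=> H r [C h] R; have R1 := repr_readin R.
have E0 : is_one (C 0 (h 0)) = head false (inp s).
  case: R => _ _ [q' [_ _ _ _ fi]] _; have := fi 0; rewrite /= addn0 => ->.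
  by case: (inp s).
have r1 : reachL r (View C h) 1 (View (upd C 0 (upd (C 0) (h 0) None)) (upd h 0 (h 0).+1)).
  exact: (reach_act (v := View C h) _ (erefl _)).
case E: (head false (inp s)) H => H; have [v' [rr R']] := H _ R1; exists v'; split=> //;
  apply: reach_if; rewrite //= E0 E; exact: reach_seq r1 rr.
Qed.

Lemma bound_le N x : n <= N -> k <= N -> bound x <= N.
Proof. by move=> nN kN; rewrite /bound /bnd; case: ifP => // _; case: ifP. Qed.

Lemma exec_out N c s : n <= N -> k <= N ->
  size (out (exec c s)) <= size (out s) + grow c N.
Proof.
move=> nN kN.
elim: c s => /= [||| x c IH|x y c IHc d IHd|a x y c IHc d IHd||c IHc d IHd|b|c IHc d IHd] s; try lia.
- apply: leq_trans (_ : _ <= size (out s) + bound x * grow c N) _; last first.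
    by rewrite leq_add2l leq_mul2r bound_le ?orbT.
  elim: (bound x) => [|j IHj] /=; first by lia.
  by apply: leq_trans (IH _) _; rewrite mulSn; lia.
- by case: ifP => _; [have := IHc s|have := IHd s]; lia.
- by case: ifP => _; [have := IHc s|have := IHd s]; lia.
- by case: ifP => _; [have /= := IHc (getin s)|have /= := IHd (getin s)]; lia.
- by rewrite size_rcons addn1.
- by have := IHd (exec c s); have := IHc s; lia.
Qed.

(** The register bound is proved together with the simulation: the time of a command depends on how
    far the preceding ones have raised the counters. [cost_mono] brings all partial costs to the
    final bound. *)
Lemma comp_correct N c s M : wf c -> n <= N -> k <= N -> N <= M ->
  (forall i, 4 < i -> reg s i <= M) ->
  sim (compile c) s (cost c (M + grow c N)) (exec c s) /\
  (forall i, 4 < i -> reg (exec c s) i <= M + grow c N).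
Proof.
move=> + nN kN; elim: c s M => /= [|x|x|x c IH|x y c IHc d IHd|a x y c IHc d IHd|a x y b|c IHc d IHd|b|c IHc d IHd] s M.
- move=> _ hM hr; split; last by move=> i hi; rewrite addn0; apply: hr.
  by move=> [C h] R; exists (View C h); split=> //; apply: reach_stay.
- move=> hx hM hr; rewrite addn0; split.
    by apply: sim_rewind; [lia|apply: hr; lia].
  by move=> i hi; rewrite /upd; case: eqP => // _; apply: hr.
- move=> hx hM hr; split; first by apply: sim_inc; lia.
  move=> i hi; rewrite /upd; case: eqP => [E|_].
    by rewrite -E addn1 ltnS; apply: hr.
  by have := hr i hi; lia.
- move=> /and3P[hx na wc] hM hr.
  have bN : bound x <= N by apply: bound_le.
  set g := grow c N; pose F := exec c.
  have fr s0 : reg (F s0) x = reg s0 x by apply: exec_frame.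
  (* Before round j the counters have grown by at most g per completed round, and the loop variable
     is j because the body cannot assign it. *)
  have mx j : j <= bound x -> forall i, 4 < i ->
      reg (iter j (fun s => incr (F s) x) (setr s x 0)) i <= M + j * g /\
      reg (iter j (fun s => incr (F s) x) (setr s x 0)) x = j.
    elim: j => [|j IHj] hj i hi.
      by rewrite /= upd_same; split=> //; rewrite /upd; case: eqP => // _; have := hr i hi; lia.
    have hj' := ltnW hj; rewrite iterS; set s1 := iter j _ _ in IHj *.
    have [_ sx] := IHj hj' i hi.
    rewrite /= upd_same fr sx; split=> //; rewrite /upd; case: eqP => [_|_]; first lia.
    have [_ H] : sim (compile c) s1 (cost c (M + j * g + g)) (exec c s1) /\
        forall i, 4 < i -> reg (exec c s1) i <= M + j * g + g.
      by apply: IH => //; [lia|move=> i' hi'; have [] := IHj hj' _ hi'].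
    by have := H i hi; rewrite /F mulSn; lia.
  have lg j : j <= bound x -> j * g <= N * g.
    by move=> hj; rewrite leq_mul2r (leq_trans hj bN) orbT.
  split; last first.
    move=> i hi; have [H _] := mx _ (leqnn _) i hi.
    by apply: leq_trans H _; rewrite leq_add2l lg.
  apply: sim_seq.
    by apply: sim_rewind; [lia|apply: leq_trans (hr x _) _; lia].
  apply: sim_le.
    apply: (@sim_while x c _ F (cost c (M + N * g)) (bound x) 0) => //.
      by rewrite /= upd_same.
    move=> j hj; have [||H _] := IH (iter j (fun s => incr (F s) x) (setr s x 0)) (M + j * g) wc.
    - by lia.
    - by move=> i hi; have [] := mx j (ltnW hj) i hi.
    apply: sim_le H _; apply: cost_mono; have := lg _ hj; rewrite mulSn -/g; lia.
  by rewrite leq_add2r leq_mul2r; apply/orP; right; lia.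
- move=> /and5P[hx hy nxy wc wd] hM hr.
  have [Hc gc] := IHc s M wc hM hr; have [Hd gd] := IHd s M wd hM hr.
  split; last by move=> i hi; case: ifP => _; [have := gc i hi|have := gd i hi]; lia.
  apply: sim_iflt => //; first by apply: leq_trans (hr x _) _; lia.
  have lc : cost c (M + grow c N) <= cost c (M + (grow c N + grow d N)) by apply: cost_mono; lia.
  have ld : cost d (M + grow d N) <= cost d (M + (grow c N + grow d N)) by apply: cost_mono; lia.
  by case: ifP => ->; [apply: sim_le Hc _|apply: sim_le Hd _]; lia.
- move=> /and5P[ha hx hy wc wd] hM hr.
  have [Hc gc] := IHc s M wc hM hr; have [Hd gd] := IHd s M wd hM hr.
  split; last by move=> i hi; case: ifP => _; [have := gc i hi|have := gd i hi]; lia.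
  apply: sim_ifarr => //; first by lia.
  have lc : cost c (M + grow c N) <= cost c (M + (grow c N + grow d N)) by apply: cost_mono; lia.
  have ld : cost d (M + grow d N) <= cost d (M + (grow c N + grow d N)) by apply: cost_mono; lia.
  by case: ifP => ->; [apply: sim_le Hc _|apply: sim_le Hd _]; lia.
- move=> /and3P[ha hx hy] hM hr; rewrite addn0; split=> //.
  by apply: sim_setarr => //; lia.
- move=> /andP[wc wd] hM hr.
  have [Hc gc] := IHc (getin s) M wc hM hr; have [Hd gd] := IHd (getin s) M wd hM hr.
  split; last by move=> i hi; case: ifP => _; [have := gc i hi|have := gd i hi]; lia.
  apply: sim_ifin.
  have lc : cost c (M + grow c N) <= cost c (M + (grow c N + grow d N)) by apply: cost_mono; lia.
  have ld : cost d (M + grow d N) <= cost d (M + (grow c N + grow d N)) by apply: cost_mono; lia.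
  by case: ifP => ->; [apply: sim_le Hc _|apply: sim_le Hd _]; lia.
- move=> _ hM hr; split; last by move=> i /hr; lia.
  move=> [C h] R.
  exists (View (upd C 0 (upd (C 0) (h 0) (Some (inl b)))) (upd h 0 (h 0).+1)); split.
    exact: (reach_act (v := View C h) _ (erefl _)).
  exact: repr_emit.
- move=> /andP[wc wd] hM hr.
  have [Hc gc] := IHc s M wc hM hr.
  have [Hd gd] := IHd (exec c s) (M + grow c N) wd (leq_trans hM (leq_addr _ _)) gc.
  rewrite addnA; split=> //; apply: sim_seq Hd; apply: sim_le Hc _.
  by apply: cost_mono; apply: leq_addr.
Qed.

End Params.

(** * Closure properties of polynomial bounds *)

Lemma polyb_le f g : (forall x, f x <= g x) -> polynomially_bounded g -> polynomially_bounded f.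
Proof. by move=> h [a [d H]]; exists a, d => x; apply: leq_trans (h x) (H x). Qed.

Lemma polyb_const c : polynomially_bounded (fun _ => c).
Proof. by exists c, 0 => x; rewrite leq_addl. Qed.

Lemma polyb_id : polynomially_bounded id.
Proof. by exists 1, 1 => x; rewrite expn1 mul1n leq_addr. Qed.

(** The summand 1 takes care of x = 0 and d = 0, where 0 ^ 0 = 1. *)
Lemma leq_exp_succ x d e : d <= e -> x ^ d <= x ^ e + 1.
Proof.
case: x => [|x] h; last by apply: leq_trans (leq_addr _ _); rewrite leq_pexp2l.
by apply: leq_trans (leq_addl _ _); case: d h => [|d] h; rewrite ?expn0 ?exp0n.
Qed.

Lemma polyb_add f g : polynomially_bounded f -> polynomially_bounded g ->
  polynomially_bounded (fun x => f x + g x).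
Proof.
move=> [a [d H]] [b [e K]]; exists ((a + b).*2), (d + e) => x.
have h1 := leq_exp_succ x (leq_addr e d); have h2 := leq_exp_succ x (leq_addl d e).
have h3 : a * x ^ d <= a * (x ^ (d + e) + 1) by rewrite leq_mul2l h1 orbT.
have h4 : b * x ^ e <= b * (x ^ (d + e) + 1) by rewrite leq_mul2l h2 orbT.
have := H x; have := K x; rewrite -muln2.
move: (x ^ (d + e)) h3 h4 => P; move: (a * x ^ d) (b * x ^ e) => A B.
rewrite !mulnDr !mulnDl; lia.
Qed.

Lemma polyb_mul f g : polynomially_bounded f -> polynomially_bounded g ->
  polynomially_bounded (fun x => f x * g x).
Proof.
(* The factor 4 counts the terms of (x^d + 1)(x^e + 1), each at most x^(d+e) + 1. *)
move=> [a [d H]] [b [e K]]; exists (4 * (a * b)), (d + e) => x.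
apply: leq_trans (leq_mul (H x) (K x)) _.
have h1 := leq_exp_succ x (leq_addr e d); have h2 := leq_exp_succ x (leq_addl d e).
have -> : (a * x ^ d + a) * (b * x ^ e + b) = a * b * (x ^ (d + e) + x ^ d + x ^ e + 1).
  by rewrite expnD; lia.
have -> : 4 * (a * b) * x ^ (d + e) + 4 * (a * b) = a * b * (4 * x ^ (d + e) + 4) by lia.
by rewrite leq_mul2l; apply/orP; right; lia.
Qed.

Lemma polyb_exp f d : polynomially_bounded f -> polynomially_bounded (fun x => f x ^ d).
Proof.
move=> hf; elim: d => [|d IH]; first exact: (polyb_const 1).
by apply: polyb_le (polyb_mul hf IH) => x; rewrite expnS.
Qed.

Lemma polyb_comp f g : polynomially_bounded f -> polynomially_bounded g ->
  polynomially_bounded (fun x => f (g x)).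
Proof.
move=> [a [d H]] hg; apply: polyb_le (_ : forall x, _ <= a * g x ^ d + a) _ => //.
apply: polyb_add (polyb_const a); apply: polyb_mul (polyb_const a) _; exact: polyb_exp.
Qed.

Lemma polyb_grow c : polynomially_bounded (grow c).
Proof.
elim: c => /= *; do ?[exact: polyb_const|exact: polyb_add|apply: polyb_mul => //; exact: polyb_id].
Qed.

Lemma polyb_cost c : polynomially_bounded (cost c).
Proof.
have id := polyb_id; have cst := polyb_const.
have S f : polynomially_bounded f -> polynomially_bounded (fun x => (f x).+1).
  by move=> hf; apply: polyb_le (polyb_add hf (cst 1)) => x; rewrite addn1.
have seek : polynomially_bounded seekM.
  by rewrite /seekM; do ![apply: polyb_add|apply: polyb_mul|apply: S].
have home : polynomially_bounded homeM.
  by rewrite /homeM; do ![apply: polyb_add|apply: polyb_mul|apply: S].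
by elim: c => /= *; do ?[assumption|apply: (cst 1)|apply: polyb_add|apply: polyb_mul|apply: S].
Qed.

(** * Reading the two unary numbers and presenting the output *)

Definition foreach (S : seq nat) (f : nat -> tprog) :=
  foldr (fun i p => TSeq (f i) p) (stay 1) S.

Lemma reach_foreach f S t C h c' h' : uniq S ->
  (forall i C2 h2, i \in S -> C2 i =1 C i -> h2 i = h i ->
     reachL (f i) (View C2 h2) t (View (upd C2 i (c' i)) (upd h2 i (h' i)))) ->
  reachL (foreach S f) (View C h) (size S * t + 1)
    (View (fun i => if i \in S then c' i else C i) (fun i => if i \in S then h' i else h i)).
Proof.
elim: S C h => [|i S IH] C h /=; first by move=> _ _; apply: reach_stay.
case/andP=> iS uS H.
apply: (@reach_weak _ _ _ (t + (size S * t + 1))).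
- apply: reach_seq; first by apply: H => //; rewrite inE eqxx.
  apply: IH => // j C2 h2 jS hC hh; apply: H; first by rewrite inE jS orbT.
    by move=> q; rewrite hC /upd; case: eqP => // E; rewrite -E jS in iS.
  by rewrite hh /upd; case: eqP => // E; rewrite -E jS in iS.
- by rewrite mulSn addnA.
- by move=> j q /=; rewrite inE /upd; case: (j =P i) => [->|]; rewrite ?(negPf iS).
- by move=> j /=; rewrite inE /upd; case: (j =P i) => [->|]; rewrite ?(negPf iS).
Qed.

Definition set_home := foreach (iota 1 last_tape) (fun i => Act i (fun _ => (mk true false, MoveN))).
Definition eat := Act 0 (fun _ => (None, MoveR)).
(** Each 1 of a unary block advances all heads in S, so at the closing 0 they stand at the number
    read, and the end marks are written there. *)
Definition load S :=
  TSeq (TWhile 0 0 (fun c _ => is_one c) (TSeq eat (foreach S mvR)))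
  (TSeq (foreach S (fun i => Act i (fun c => (mk (is_home c) true, MoveN))))
  (TSeq (foreach S rewind) eat)).

Definition loadT b s :=
  b * (1 + (s * 1 + 1)).+1 + 1 + (s * 1 + 1 + (s * (b * 2 + 1) + 1 + 1)).

Definition blank_home (q : nat) := mk (q == 0) false.

Lemma reach_load S C h b rest : uniq S -> {in S, forall i, 0 < i <= last_tape} ->
  {in S, forall i, C i =1 blank_home} -> {in S, forall i, h i = 0} ->
  (forall j, C 0 (h 0 + j) =
     nth None [seq Some (inl b) | b <- nseq b true ++ false :: rest] j) ->
  exists C0, reachL (load S) (View C h) (loadT b (size S))
    (View (fun i => if i == 0 then C0
                    else if i \in S then fun q => mk (q == 0) (q == b) else C i)
          (upd h 0 (h 0 + b.+1)))
  /\ (C0 (h 0 + b) = None /\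
      forall j, C0 (h 0 + b.+1 + j) = nth None [seq Some (inl b) | b <- rest] j).
Proof.
move=> uS hS hC hh hio.
have S0 : 0 \notin S by apply/negP => /hS.
pose f j := fun q => if h 0 <= q < h 0 + j then None else C 0 q.
pose v j := View (upd C 0 (f j)) (fun i => if i == 0 then h 0 + j else if i \in S then j else h i).
have r1 : reachL (TWhile 0 0 (fun c _ => is_one c) (TSeq eat (foreach S mvR)))
    (v 0) (b * (1 + (size S * 1 + 1)).+1 + 1) (v b).
  apply: reach_while => //= [j hj|j hj|].
  - by rewrite upd_same /f ltnn andbF hio map_cat nth_cat size_map size_nseq hj
               (nth_map true) ?size_nseq // nth_nseq hj.
  - apply: reach_weak.
    + apply: reach_seq; first by apply: (reach_act (v := v j) _ (erefl _)).
      apply: (@reach_foreach _ _ 1 _ _ (upd C 0 (f j)) (fun=> j.+1)) => // i C2 h2 iS hC2 hh2.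
      have /andP[i0 i17] := hS i iS.
      apply: reach_weak; first exact: reach_mvR.
      * by [].
      * move=> l q /=; rewrite /upd; case: (l =P i) => // ->; rewrite hC2 /= /upd.
        by case: eqP => // E; rewrite E in i0.
      * move=> l /=; rewrite /upd; case: (l =P i) => // _; rewrite hh2 /= /upd.
        by case: eqP => // E; [rewrite E in i0|rewrite iS].
    + by [].
    + move=> i q /=; case iS: (i \in S).
        by rewrite /upd; case: eqP => // E; rewrite E (negPf S0) in iS.
      rewrite /upd; case: eqP => // _; rewrite eqxx /f.
      case: eqP => [->|nq]; first by rewrite leq_addr ltn_add2l ltnS leqnn.
      by congr (if _ then _ else _); lia.
    + move=> i /=; case iS: (i \in S).
        by case: eqP => // E; rewrite E (negPf S0) in iS.
      by rewrite /upd; case: (i =P 0) => _; rewrite ?addnS ?iS.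
  - by rewrite upd_same /f ltnn andbF hio map_cat nth_cat size_map size_nseq ltnn subnn.
pose c2 i := if i \in S then upd (C i) b (mk (b == 0) true) else upd C 0 (f b) i.
have r2 : reachL (foreach S (fun i => Act i (fun c => (mk (is_home c) true, MoveN))))
    (v b) (size S * 1 + 1) (View c2 (pos (v b))).
  apply: reach_weak.
    apply: (@reach_foreach _ _ 1 _ _ c2 (fun=> b)) => // i C2 h2 iS hC2 hh2.
    have /andP[i0 i17] := hS i iS.
    have i0' : (i == 0) = false by apply/negbTE; rewrite -lt0n.
    apply: reach_weak; first by apply: reach_act.
    - by [].
    - move=> l q /=; rewrite /upd; case: (l =P i) => // _; rewrite /c2 iS hh2 /= iS i0' /upd.
      by rewrite !hC2 /= /upd i0' hC // /blank_home is_home_mk.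
    - by move=> l /=; rewrite /upd; case: (l =P i) => // _; rewrite hh2 /= i0' iS.
  - by [].
  - by move=> i q /=; case iS: (i \in S); rewrite /c2 iS.
  - move=> i /=; case iS: (i \in S) => //.
    by case: eqP => // E; rewrite E (negPf S0) in iS.
pose h3 i := if i == 0 then h 0 + b else h i.
have r3 : reachL (foreach S rewind) (View c2 (pos (v b))) (size S * (b * 2 + 1) + 1) (View c2 h3).
  apply: reach_weak.
    apply: (@reach_foreach _ _ (b * 2 + 1) _ _ c2 (fun=> 0)) => // i C2 h2 iS hC2 hh2.
    have /andP[i0 i17] := hS i iS.
    have i0' : (i == 0) = false by apply/negbTE; rewrite -lt0n.
    apply: reach_weak.
    - apply: reach_rewind => // q; rewrite /= hC2 /c2 iS /upd.
      by case: eqP => [->|_]; rewrite ?is_home_mk // hC // /blank_home is_home_mk.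
    - by rewrite hh2 /= i0' iS.
    - by move=> l q /=; rewrite /upd; case: (l =P i) => // ->; rewrite hC2.
    - by [].
  - by [].
  - by move=> i q /=; case: ifP.
  - move=> i /=; rewrite /h3; case iS: (i \in S); last by [].
    by case: (i =P 0) => [E|_]; [rewrite E (negPf S0) in iS|rewrite hh].
exists (upd (f b) (h 0 + b) None); split; last first.
  split; first by rewrite upd_same.
  move=> j; rewrite /upd /f; case: eqP => [E|_]; first lia.
  have -> : (h 0 <= h 0 + b.+1 + j < h 0 + b) = false by lia.
  rewrite -addnA hio map_cat nth_cat size_map size_nseq.
  have -> : (b.+1 + j < b) = false by lia.
  by have -> : b.+1 + j - b = j.+1 by lia.
apply: (@reach_pre _ _ (v 0)) => /= [i|i|].
- by move=> q; rewrite /upd; case: eqP => // ->; rewrite /f; case: ifP => //; lia.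
- by case: eqP => [->|_]; [rewrite addn0|case: ifP => // /hh].
apply: (reach_seq r1); apply: (reach_seq r2); apply: (reach_seq r3).
apply: reach_weak; first by apply: (reach_act (v := View c2 h3) _ (erefl _)).
- by [].
- move=> i q /=; rewrite {1}/upd; case: (i =P 0) => [_|ni].
    by rewrite /c2 (negPf S0) /h3 /upd.
  rewrite /c2; case: ifP => iS; last by rewrite /upd; case: eqP.
  by rewrite /upd; case: (q =P b) => [->|_] //; rewrite hC.
- by move=> i /=; rewrite /h3 /upd; case: (i =P 0) => // _; rewrite addnS.
Qed.

Definition init_state w := State (fun=> 0) (fun _ _ _ => false) w [::].

(** The order is that of the encoding: the block for k comes before the block for n. *)
Definition prelude := TSeq set_home (TSeq (load [:: 8; 9; 10]) (load [:: 2; 11; 12; 13; 14; 15; 16; 17])).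

Lemma reach_prelude n k w C h :
  (forall j, C 0 j = nth None [seq Some (inl b) | b <-
     nseq k true ++ false :: nseq n true ++ false :: w] j) ->
  (forall i j, 0 < i -> C i j = None) -> (forall i, h i = 0) ->
  exists v, reachL prelude (View C h) (17 * 1 + 1 + (loadT k 3 + loadT n 8)) v /\
    state_rep n k (init_state w) v.
Proof.
move=> h0 hC hh.
pose C1 i := if i \in iota 1 last_tape then blank_home else C i.
have r1 : reachL set_home (View C h) (17 * 1 + 1) (View C1 h).
  apply: reach_weak.
    apply: (@reach_foreach _ _ 1 _ _ (fun=> blank_home) (fun=> 0)) => // i C2 h2 iS hC2 hh2.
    have /andP[i0 i17] : 0 < i < 18 by move: iS; rewrite mem_iota.
    apply: reach_weak; first by apply: reach_act.
    - by [].
    - move=> l q /=; rewrite /upd; case: (l =P i) => // _; rewrite hh2 hh hC2 hC // /blank_home.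
      by case: (q == 0).
    - by move=> l /=; rewrite /upd; case: (l =P i) => // _; rewrite hh2 hh.
  - by [].
  - by [].
  - by move=> i /=; rewrite hh; case: ifP.
have [|||||C2 [r2 [_ io2]]] := @reach_load [:: 8; 9; 10] C1 h k (nseq n true ++ false :: w).
- by [].
- by apply/allP.
- by move=> i; rewrite !inE => /or3P[]/eqP->.
- by move=> i _; apply: hh.
- by move=> j; rewrite hh /C1 /= add0n h0.
set v2 := (X in @reach _ _ _ _ X) in r2; pose S2 := [:: 2; 11; 12; 13; 14; 15; 16; 17].
have [|||||C3 [r3 [nb io3]]] := @reach_load S2 (cont v2) (pos v2) n w.
- by [].
- by apply/allP.
- by move=> i iS q; move: iS; rewrite !inE; do 7![case/orP=> [/eqP->//|]]; move/eqP->.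
- move=> i iS; have i0 : (i == 0) = false by case: i iS.
  by rewrite /v2 /= /upd i0.
- by move=> j; rewrite /v2 /= upd_same io2.
set v3 := (X in @reach _ _ _ _ X) in r3.
pose v := View (fun i => if i == 0 then C3 else content n k (init_state w) i) (upd (fun=> 0) 0 (pos v3 0)).
exists v; split.
  apply: reach_weak_in (reach_seq r1 (reach_seq r2 r3)) _ => i hi.
  have SE (b q : nat) : (Some b == Some q) = (q == b) by rewrite eq_sym.
  (* The computed view is compared with the intended one tape by tape, for the 18 existing tapes. *)
  do 18![case: i hi => [|i] hi;
    first by split; rewrite /= /upd /= ?hh // => q; rewrite /content /= ?SE].
  by [].
split=> //= [i hi|i hi|].
- by move=> q; rewrite eqn0Ngt hi.
- by rewrite /upd eqn0Ngt hi; case: ifP.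
exists (pos v3 0); rewrite /= !upd_same in nb io3 *; split=> //=.
- by rewrite addnS.
- by rewrite addnS /= nb.
- by rewrite addn0.
Qed.

(** The output is read rightwards from the head, which therefore walks left to the blank before the
    first bit and then one cell to the right. *)
Definition finish := TSeq (mvL 0) (TSeq (TWhile 0 0 (fun c _ => is_bit c) (mvL 0)) (mvR 0)).

Lemma reach_finish n k s v : state_rep n k s v -> inp s = [::] ->
  exists v', reachL finish v (1 + (size (out s) * 2 + 1 + 1)) v' /\
    forall j, cont v' 0 (pos v' 0 + j) = nth None [seq Some (inl b) | b <- out s] j.
Proof.
case: v => C h [_ _ [q [/= q0 fq pq fo fi]] _] i0.
exists (View C (upd h 0 q)); split; last first.
  move=> j /=; rewrite upd_same; case: (ltnP j (size (out s))) => hj.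
    by rewrite fo // (nth_map false).
  rewrite nth_default ?size_map //.
  have := fi (j - size (out s)); rewrite i0 nth_nil pq => <-.
  by congr (C 0 _); lia.
pose g i := upd h 0 (q + size (out s) - 1 - i).
apply: (@reach_seq _ _ _ _ _ (View C (g 0))).
  apply: reach_weak; first by apply: reach_mvL => //; lia.
  - by [].
  - by [].
  - by move=> i /=; rewrite /g pq subn0 subn1.
apply: (@reach_seq _ _ _ _ _ (View C (g (size (out s))))).
  apply: (@reach_while _ _ _ _ _ (fun i => View C (g i))) => //= [i hi|i hi|].
  - rewrite /g upd_same; have -> : q + size (out s) - 1 - i = q + (size (out s) - i.+1) by lia.
    by rewrite fo //; lia.
  - apply: reach_weak; first by apply: reach_mvL => //; rewrite /g upd_same; lia.
    + by [].
    + by [].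
    + by move=> j /=; rewrite /g upd_same /upd; case: eqP => // _; lia.
  - rewrite /g upd_same; have -> : q + size (out s) - 1 - size (out s) = q.-1 by lia.
    by rewrite fq.
apply: reach_weak; first exact: reach_mvR.
- by [].
- by [].
- by move=> j /=; rewrite /g upd_same /upd; case: eqP => // _; lia.
Qed.

Lemma read_bits_nth (r : seq mcell) (w : seq bool) :
  (forall j, nth None r j = nth None [seq Some (inl b) | b <- w] j) -> read_bits r = w.
Proof.
elim: w r => [|b w IH] [|c r] H //=.
- by have /= -> := H 0.
- by have := H 0.
- by have /= -> := H 0; rewrite IH // => j; apply: (H j.+1).
Qed.

(** Both numbers are given in unary, so n and k are at most the input length L, and L can be used
    for every parameter of the time bounds. *)
Theorem cmd_machine c : wf c ->
  exists (M : turing_machine) (p : nat -> nat), polynomially_bounded p /\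
  forall n k w (x := nseq k true ++ false :: nseq n true ++ false :: w)
    (s := exec n k c (init_state w)),
  inp s = [::] -> tm_computes_within M (p (size x)) x (out s).
Proof.
move=> wc; exists (machine last_tape (TSeq prelude (TSeq (compile c) finish))).
pose p L := 17 * 1 + 1 + (loadT L 3 + loadT L 8) +
  (cost c (L + grow c L) + (1 + (grow c L * 2 + 1 + 1))).
exists p; split.
  rewrite /p /loadT; have id := polyb_id; have cst := polyb_const; have gr := polyb_grow c.
  have S f : polynomially_bounded f -> polynomially_bounded (fun x => (f x).+1).
    by move=> hf; apply: polyb_le (polyb_add hf (cst 1)) => x; rewrite addn1.
  have co : polynomially_bounded (fun L => cost c (L + grow c L)).
    by apply: polyb_comp (polyb_cost c) _; apply: polyb_add.
  by do ![assumption|apply: cst|apply: polyb_add|apply: polyb_mul|apply: S].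
move=> n k w x s i0; set L := size x.
have LE : L = k + (n + size w).+2.
  by rewrite /L /x !size_cat /= !size_cat /= !size_nseq; lia.
have [nL kL] : n <= L /\ k <= L by lia.
pose C i := nth None (if i == 0 then [seq Some (inl b) | b <- x] else [::] : seq mcell).
have [||//|v1 [r1 R1]] := @reach_prelude n k w C (fun=> 0).
- by [].
- by move=> i j hi; rewrite /C eqn0Ngt hi nth_nil.
have [|H _] := @comp_correct n k L c (init_state w) L wc nL kL (leqnn _).
  by [].
have [v2 [r2 R2]] := H _ R1.
have [v3 [r3 out3]] := reach_finish R2 i0.
have gr : size (out s) <= grow c L by have := exec_out c (init_state w) nL kL.
have r : reachL (TSeq prelude (TSeq (compile c) finish)) (View C (fun=> 0)) (p L) v3.
  apply: reach_le (reach_seq r1 (reach_seq r2 r3)) _.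
  by rewrite /p /loadT -/s; lia.
pose T : {ffun 'I_18 -> tape mark} := [ffun i => Tape [::] (if i == ord0
   then [seq Some (inl b) | b <- x] else [::])].
have [|t [T' [tp rn RT]]] := r T.
  by move=> i; rewrite ffunE /= /tape_rep /=; split=> // j; rewrite add0n /C.
have := machine_runs rn; set M := machine _ _ => it.
rewrite /tm_computes_within.
have -> : iter (p L) (@tm_step M) (tm_init M x) = @Config M None T'.
  by rewrite -(subnK tp) iterD it machine_halted.
split=> //; apply: read_bits_nth => j.
by have [_ ->] := RT ord0; apply: out3.
Qed.

(** * The kernelization program *)

Fixpoint writes a c :=
  match c with
  | SetArr b _ _ _ => a == b
  | For _ c => writes a c
  | IfLt _ _ c d | IfArr _ _ _ c d | IfIn c d | Sq c d => writes a c || writes a d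
  | _ => false
  end.

(** * Frame properties and loop invariants *)

Section Execution.
Variables n k : nat.
Notation exec := (exec n k).
Notation bound := (bound n k).

Lemma exec_arr_frame a c s : ~~ writes a c -> arr (exec c s) a = arr s a.
Proof.
elim: c s => //= [x c IH|y z c IHc d IHd|b y z c IHc d IHd|b y z v|c IHc d IHd|c IHc d IHd] s.
- by move=> na; elim: (bound x) => //= j <-; rewrite IH.
- by rewrite negb_or => /andP[? ?]; case: ifP => _; auto.
- by rewrite negb_or => /andP[? ?]; case: ifP => _; auto.
- by move=> /negPf na; rewrite {1}/upd na.
- by rewrite negb_or => /andP[? ?]; case: ifP => _; [rewrite IHc|rewrite IHd].
- by rewrite negb_or => /andP[? ?]; rewrite IHd // IHc.
Qed.

Lemma exec_inp_nil c s : inp s = [::] -> inp (exec c s) = [::].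
Proof.
elim: c s => //= [x c IH|y z c IHc d IHd|b y z c IHc d IHd|c IHc d IHd|b|c IHc d IHd] s E.
- by elim: (bound x) => //= j E'; apply: IH.
- by case: ifP; auto.
- by case: ifP; auto.
- by case: ifP => _; [apply: IHc|apply: IHd]; rewrite /= E.
- by rewrite E.
- by apply: IHd; apply: IHc.
Qed.

Fixpoint silent c :=
  match c with
  | Emit _ => false
  | For _ c => silent c
  | IfLt _ _ c d | IfArr _ _ _ c d | IfIn c d | Sq c d => silent c && silent d
  | _ => true
  end.

Lemma exec_silent c s : silent c -> out s = [::] -> out (exec c s) = [::].
Proof.
elim: c s => //= [x c IH|y z c IHc d IHd|b y z c IHc d IHd|c IHc d IHd|c IHc d IHd] s.
- by move=> sc o; elim: (bound x) => //= j; apply: IH.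
- by move=> /andP[? ?] o; case: ifP; auto.
- by move=> /andP[? ?] o; case: ifP; auto.
- by move=> /andP[? ?] o; case: ifP; auto.
- by move=> /andP[? ?] o; auto.
Qed.

Definition frame c s s' :=
  (forall z, ~~ assigned z c -> reg s' z = reg s z) /\
  (forall a, ~~ writes a c -> arr s' a = arr s a).

(** The invariant rule for loops. The body may also assume that everything the loop does not assign
    or write still has its initial value. *)
Lemma exec_for_ind (I : nat -> state -> Prop) x c s : ~~ assigned x c ->
  I 0 (setr s x 0) ->
  (forall i s', i < bound x -> reg s' x = i -> frame (For x c) s s' ->
     I i s' -> I i.+1 (incr (exec c s') x)) ->
  I (bound x) (exec (For x c) s).
Proof.
move=> na I0 IS /=; pose F s := incr (exec c s) x.
suff H j : j <= bound x -> let s' := iter j F (setr s x 0) in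
    [/\ reg s' x = j, frame (For x c) s s' & I j s'] by case: (H _ (leqnn _)).
elim: j => [|j IH] hj /=.
  split=> //; first by rewrite /= upd_same.
  by split=> //= z; rewrite negb_or /upd => /andP[/negPf->].
have [hx [fr fa] hI] := IH (ltnW hj); split; last exact: IS.
  by rewrite /= upd_same exec_frame // hx.
split=> [z nz|a wa]; last by rewrite /= exec_arr_frame // fa.
move: (nz) => /=; rewrite negb_or => /andP[/negPf zx zc].
by rewrite /= {1}/upd zx exec_frame // fr.
Qed.

Lemma exec_for_out x c s (f : nat -> seq bool) : ~~ assigned x c ->
  (forall i s', i < bound x -> reg s' x = i -> frame (For x c) s s' ->
     out (exec c s') = out s' ++ f i) ->
  out (exec (For x c) s) = out s ++ flatten [seq f i | i <- iota 0 (bound x)].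
Proof.
move=> na H; pose I j s' := out s' = out s ++ flatten [seq f i | i <- iota 0 j].
apply: (exec_for_ind (I := I)) => //; first by rewrite /I /= cats0.
move=> i s' hi hx fr hI.
by rewrite /I -[i.+1]addn1 iotaD map_cat flatten_cat catA -hI /= cats0 (H i).
Qed.

End Execution.

(** * The text of the program *)

Local Notation rA := 3 (only parsing).
Local Notation rR := 4 (only parsing).
Local Notation rc := 5 (only parsing).
Local Notation rt := 6 (only parsing).
Local Notation rm := 7 (only parsing).
Local Notation rp := 11 (only parsing).
Local Notation rq := 12 (only parsing).
Local Notation ra := 13 (only parsing).
Local Notation rb := 14 (only parsing).
Local Notation rr := 15 (only parsing).
Local Notation rx := 16 (only parsing).
Local Notation ry := 17 (only parsing).

Definition set_sym x y b := Sq (SetArr rA x y b) (SetArr rA y x b).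

Definition read_matrix := For rx (For ry (IfIn (SetArr rA rx ry true) (SetArr rA rx ry false))).

Definition set_threshold := Sq (Inc rt) (Sq (Inc rt) (For 8 (Sq (Inc rt) (Inc rt)))).

(** The first 2k+2 common neighbours are counted and kept; they serve as the set C of [twin_rule]
    whenever a later one is cut from a. *)
Definition twin_pair := Sq (Zero rc) (For rx (IfArr rA ra rx
  (IfArr rA rb rx (IfLt rc rt (Inc rc) (set_sym ra rx false)) Skip) Skip)).

Definition twin_pass := For ra (For rb (IfLt ra rb twin_pair Skip)).

(* The diagonal of the array [rR] serves as a set of vertices. *)
Definition search_round :=
  For rx (IfArr rR rx rx (For ry (IfArr rA rx ry (SetArr rR ry ry true) Skip)) Skip).
Definition search :=
  Sq (For rx (SetArr rR rx rx false)) (Sq (SetArr rR ra ra true) (For rr search_round)).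

(** The edge is removed tentatively and put back if b can still be reached from a. *)
Definition bridge_pair := IfArr rA ra rb
  (Sq (set_sym ra rb false) (Sq search (IfArr rR rb rb (set_sym ra rb true) Skip))) Skip.

Definition bridge_pass := For ra (For rb bridge_pair).

(** The language has no loop that runs until nothing changes; the two nested loops provide n * n
    rounds instead. *)
Definition reduce := For rp (For rq (Sq twin_pass bridge_pass)).

Definition mark_alive :=
  Sq (Zero rm) (For rx (Sq (SetArr rR rx rx false)
    (Sq (For ry (IfArr rA rx ry (SetArr rR rx rx true) Skip))
        (IfArr rR rx rx (Inc rm) Skip)))).

(** Multiplication is done by nesting loops, and nested loops need distinct variables; hence three
    variables bounded by k. *)
Definition cubic := Sq (Zero rc) (For 8 (For 9 (For 10 (iter 18 (Sq (Inc rc)) Skip)))).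

Definition emits (w : seq bool) := foldr (fun b c => Sq (Emit b) c) Skip w.

(** Parameter 0 is [0], the vertex count 3 is [1110], and the rows of the triangle are [011], [101],
    [110]. *)
Definition no_instance :=
  [:: false; true; true; true; false; false; true; true; true; false; true; true; true; false].

Definition emit_graph :=
  Sq (For 8 (Emit true)) (Sq (Emit false)
  (Sq (For rx (IfArr rR rx rx (Emit true) Skip)) (Sq (Emit false)
  (For rx (IfArr rR rx rx
     (For ry (IfArr rR ry ry (IfArr rA rx ry (Emit true) (Emit false)) Skip)) Skip))))).

Definition kernel :=
  Sq read_matrix (Sq set_threshold (Sq reduce (Sq mark_alive (Sq cubic
    (IfLt rc rm (emits no_instance) emit_graph))))).

Lemma wf_kernel : wf kernel. Proof. by []. Qed.

(** * Correctness of the program *)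

Section Kernel.
Variables n k : nat.
Notation exec := (exec n k).
Notation bound := (bound n k).
Implicit Types (s : state) (E : rel 'I_n).

Definition edges s : rel 'I_n := fun i j => arr s rA i j.

Lemma read_matrixP s w : inp s = w -> size w = n * n ->
  let s' := exec read_matrix s in
  inp s' = [::] /\ forall i j : 'I_n, edges s' i j = nth false w (i * n + j).
Proof.
move=> iw sw.
pose I p s' := inp s' = drop p w /\
  forall i j, j < n -> i * n + j < p -> arr s' rA i j = nth false w (i * n + j).
suff [i1 H] : I (n * n) (exec read_matrix s).
  split; first by rewrite i1 -sw drop_size.
  by move=> i j; rewrite /edges H //; have := ltn_ord i; have := ltn_ord j; nia.
apply: (@exec_for_ind n k (fun i s => I (i * n) s)) => //.
  by split=> //=; rewrite iw drop0.
move=> i s1 hi hx _ I1.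
suff H : I (i * n + n) (exec (For ry (IfIn (SetArr rA rx ry true) (SetArr rA rx ry false))) s1).
  by rewrite mulSn addnC.
apply: (@exec_for_ind n k (fun j s => I (i * n + j) s)) => //.
  by rewrite addn0.
move=> j s2 hj hy [fr _] [i2 H2]; have {}hj : j < n := hj.
have {}hx : reg s2 rx = i by rewrite fr.
have hd : head false (inp s2) = nth false w (i * n + j) by rewrite i2 -nth0 nth_drop addn0.
have b2 : behead (inp s2) = drop (i * n + j.+1) w.
  by rewrite i2 -[behead _]drop1 drop_drop addnS add1n.
rewrite /I /= hd.
have -> : forall c, (if c then seta (getin s2) rA (reg s2 rx) (reg s2 ry) true
    else seta (getin s2) rA (reg s2 rx) (reg s2 ry) false)
    = seta (getin s2) rA i j c by move=> c; rewrite hx hy; case: c.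
split; first by rewrite /= b2.
move=> i' j' hj' lt; rewrite /= /upd /=; case: (i' =P i) => [Ei|ni].
  by subst i'; case: (j' =P j) => [->//|nj]; apply: H2 => //; lia.
apply: H2 => //; case: (ltngtP i' i) ni => // lti _.
  by have : i'.+1 * n <= i * n by [rewrite leq_mul2r lti orbT]; rewrite mulSn; lia.
by have : i.+1 * n <= i' * n by [rewrite leq_mul2r lti orbT]; rewrite mulSn; lia.
Qed.

Lemma set_thresholdP s : reg s rt = 0 -> reg (exec set_threshold s) rt = 2 * k + 2.
Proof.
move=> t0; rewrite /set_threshold /=.
set s1 := incr _ _; have t1 : reg s1 rt = 2 by rewrite /s1 /= /upd /= t0.
apply: (@exec_for_ind n k (fun i s => reg s rt = 2 * i + 2) 8 (Sq (Inc rt) (Inc rt)) s1) => //=.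
by move=> i s2 _ _ _ E; rewrite /= /upd /= E; lia.
Qed.

(** The contract of a reduction step. The last clause turns an idle step into the information that
    the graph is reduced with respect to [P]. *)
Definition pass (P : rel 'I_n -> Prop) E E' := symmetric E -> irreflexive E ->
  [/\ subrel E' E, symmetric E', solvable E' k -> solvable E k & E' = E <-> P E].

Lemma rel_antisym E E' : subrel E E' -> subrel E' E -> E = E'.
Proof.
move=> h1 h2; apply: functional_extensionality => i.
by apply: functional_extensionality => j; apply/idP/idP => [/h1|/h2].
Qed.

Lemma sub_irreflexive E E' : subrel E' E -> irreflexive E -> irreflexive E'.
Proof. by move=> sub ie i; apply/negP => /sub; rewrite ie. Qed.

(** Edges only disappear, so if the composite changes nothing, neither does its first half, and both
    idleness clauses apply to the same graph. *)
Lemma pass_seq P Q E1 E2 E3 : pass P E1 E2 -> pass Q E2 E3 ->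
  pass (fun E => P E /\ Q E) E1 E3.
Proof.
move=> p1 p2 s1 i1; have [b1 s2 v1 e1] := p1 s1 i1.
have [b2 s3 v2 e2] := p2 s2 (sub_irreflexive b1 i1).
split=> //; [by move=> i j /b2/b1|by move/v2/v1|].
split=> [E31|[/e1 E21]].
  have E21 : E2 = E1 by apply: rel_antisym => //; rewrite -E31.
  by split; [apply/e1|rewrite -E21; apply/e2; rewrite E31].
by rewrite -E21 => /e2 ->.
Qed.

Lemma pass_skip (P : rel 'I_n -> Prop) E : P E -> pass P E E.
Proof. by move=> pe se ie; split. Qed.

Lemma pass_equiv (P Q : rel 'I_n -> Prop) E E' : (P E <-> Q E) -> pass P E E' -> pass Q E E'.
Proof. by move=> pq p se ie; have [? ? ? e] := p se ie; split=> //; rewrite -pq. Qed.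

Lemma pass_for (P : nat -> rel 'I_n -> Prop) x c s : ~~ assigned x c ->
  (forall i s', i < bound x -> reg s' x = i -> frame (For x c) s s' ->
     pass (P i) (edges s') (edges (exec c s'))) ->
  pass (fun E => forall i, i < bound x -> P i E) (edges s) (edges (exec (For x c) s)).
Proof.
move=> na H.
apply: (@exec_for_ind n k (fun j s' =>
  pass (fun E => forall i, i < j -> P i E) (edges s) (edges s'))) => //.
  exact: pass_skip.
move=> i s' hi hx fr p; apply: pass_equiv (pass_seq p (H i s' hi hx fr)).
split=> [[h1 h2] j|h].
  by rewrite ltnS leq_eqVlt => /orP[/eqP->//|/h1].
by split=> [j hj|]; apply: h => //; apply: ltnW.
Qed.

Lemma edges_set_sym x y b s (u v : 'I_n) : reg s x = u -> reg s y = v ->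
  edges (exec (set_sym x y b) s) =
  fun i j => if same_edge u v i j then b else edges s i j.
Proof.
move=> hx hy; apply: functional_extensionality => i.
apply: functional_extensionality => j.
rewrite /edges /= hx hy /upd /= /same_edge -!val_eqE /=.
by case: (i =P v :> nat) => [->|]; case: (j =P u :> nat) => [->|]; case: (v =P u :> nat) => [->|];
  rewrite ?eqxx ?andbF ?andbT ?orbT ?orbF //=; case: eqP => // ->; rewrite ?eqxx.
Qed.

Lemma edges_del x y s (u v : 'I_n) : reg s x = u -> reg s y = v ->
  edges (exec (set_sym x y false) s) = del_edge (edges s) u v.
Proof.
move=> hx hy; rewrite (edges_set_sym _ hx hy); apply: functional_extensionality => i.
apply: functional_extensionality => j; rewrite /del_edge /=.
by case: same_edge; rewrite ?andbF ?andbT.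
Qed.

Definition few_common (u v : 'I_n) E := #|[set w | E u w && E v w]| <= 2 * k + 2.

(** Invariant before vertex t: the counter is the number of common neighbours below t in the current
    graph and is at most 2k+2; if the original pair had few common neighbours, nothing has been
    cut. *)
Lemma twin_pairP s (u v : 'I_n) : reg s ra = u -> reg s rb = v -> u != v ->
  reg s rt = 2 * k + 2 -> pass (few_common u v) (edges s) (edges (exec twin_pair s)).
Proof.
move=> hu hv nuv ht se ie; set E0 := edges s.
pose common (E : rel 'I_n) t := [set w : 'I_n | (w < t) && (E u w && E v w)].
have common_n E : common E n = [set w | E u w && E v w].
  by apply/setP => w; rewrite !inE ltn_ord.
pose J t E c := [/\ subrel E E0, symmetric E, solvable E k -> solvable E0 k,
  #|common E t| = c /\ c <= 2 * k + 2 & few_common u v E0 -> E = E0].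
pose I t s' := J t (edges s') (reg s' rc).
suff [b1 s1 v1 [c1 c2] f1] : I n (exec twin_pair s).
  split=> //; split=> // E1; rewrite /few_common -common_n -/E0 -E1 c1 //.
rewrite /twin_pair /=.
apply: (@exec_for_ind n k I rx (IfArr rA ra rx
  (IfArr rA rb rx (IfLt rc rt (Inc rc) (set_sym ra rx false)) Skip) Skip)) => //.
  split=> //; split; last by rewrite /= /upd.
  by rewrite /= /upd /=; apply: eq_card0 => w; rewrite inE.
move=> t s' lt hx [fr _] [b1 s1 v1 [c1 c2] f1].
have {}lt : t < n := lt; pose w := Ordinal lt.
have {}hu : reg s' ra = u by rewrite fr.
have {}hv : reg s' rb = v by rewrite fr.
have {}ht : reg s' rt = 2 * k + 2 by rewrite fr.
set E := edges s' in b1 s1 v1 c1 f1.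
have ie1 : irreflexive E := sub_irreflexive b1 ie.
have wnot : w \notin common E t by rewrite inE ltnn.
have commS (E' : rel 'I_n) : common E' t.+1 =
    if E' u w && E' v w then w |: common E' t else common E' t.
  apply/setP => z; rewrite (fun_if (fun A : {set 'I_n} => z \in A)) !inE ltnS leq_eqVlt.
  have -> : (z == t :> nat) = (z == w) by rewrite -val_eqE.
  case: (z =P w) => [->|_] /=; last by case: ifP.
  by rewrite ltnn /=; case: ifP.
have eA p (q : 'I_n) : reg s' p = q -> arr s' rA (reg s' p) (reg s' rx) = E q w.
  by move=> ->; rewrite hx.
set c := IfArr _ _ _ _ _ in fr *.
suff : J t.+1 (edges (exec c s')) (reg (exec c s') rc) by [].
rewrite /c [exec _ _]/= (eA _ _ hu).
case Euw: (E u w); last by rewrite -/E; split=> //; rewrite commS Euw.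
rewrite (eA _ _ hv); case Evw: (E v w); last by rewrite -/E; split=> //; rewrite commS Euw Evw.
rewrite ht; case: (ltnP (reg s' rc) (2 * k + 2)) => hc.
  suff : J t.+1 E (reg s' rc).+1 by [].
  by split=> //; rewrite commS Euw Evw cardsU1 wnot c1.
have cE : #|common E t| = 2 * k + 2 by lia.
have nuw : u != w by apply: contraTneq Euw => <-; rewrite ie1.
have nvw : v != w by apply: contraTneq Evw => <-; rewrite ie1.
have hw : reg s' rx = w by rewrite hx.
rewrite -[seta _ _ _ _ _]/(exec (set_sym ra rx false) s') (edges_del hu hw) -/E.
have Cw : {in w |: common E t, forall z, E u z && E v z}.
  by move=> z; rewrite in_setU1 inE => /orP[/eqP->|/andP[]//]; rewrite Euw.
split.
- by move=> i j /del_edge_sub /b1.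
- exact: del_edge_sym.
- move=> sol; apply: v1; apply: (twin_rule s1 ie1 nuv wnot Cw) sol.
  by rewrite cE.
(* The cut removes w from the common neighbours and changes none of those below t, so the counter
   remains right. *)
- suff -> : #|common (del_edge E u w) t.+1| = #|common E t| by [].
  rewrite commS.
  have -> : del_edge E u w u w = false by rewrite /del_edge /= /same_edge !eqxx andbF.
  congr #|pred_of_set _|; apply/setP => z; rewrite !inE.
  case: (ltnP z t) => //= zt; have nzw : (z == w) = false by rewrite -val_eqE /= ltn_eqF.
  rewrite /del_edge /= /same_edge nzw (eq_sym v u) (negPf nuv) (negPf nuw) (negPf nvw).
  by rewrite !andbF !andbT.
(* A cut takes place only when w is a further common neighbour beyond 2k+2 others, which contradicts
   [few]. *)
move=> few; suff : #|w |: common E t| <= 2 * k + 2 by rewrite cardsU1 wnot cE; lia.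
apply: leq_trans few; apply: subset_leq_card; apply/subsetP => z /Cw.
by rewrite inE => /andP[/b1-> /b1->].
Qed.

Lemma arr_seta_diag s a j b i : arr (seta s a j j b) a i i = if i == j then b else arr s a i i.
Proof. by rewrite /= /upd eqxx; case: (i =P j) => [->|]; rewrite ?eqxx. Qed.

Definition marked s (i : 'I_n) := arr s rR i i.

(** [P] is any set closed under adjacency; taking the component of the start vertex gives soundness
    of the marks. *)
Lemma search_rowP s (P : pred 'I_n) (i : 'I_n) : reg s rx = i -> P i ->
  (forall j, marked s j -> P j) -> (forall i j, P i -> edges s i j -> P j) ->
  let s' := exec (For ry (IfArr rA rx ry (SetArr rR ry ry true) Skip)) s in
  [/\ forall j, marked s j -> marked s' j, forall j, edges s i j -> marked s' j
    & forall j, marked s' j -> P j].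
Proof.
move=> hi Pi P0 PS.
pose I t s' := [/\ forall j, marked s j -> marked s' j,
  forall j : 'I_n, j < t -> edges s i j -> marked s' j & forall j, marked s' j -> P j].
suff [h1 h2 h3] : I n (exec (For ry (IfArr rA rx ry (SetArr rR ry ry true) Skip)) s).
  by split=> // j; apply: h2.
apply: (@exec_for_ind n k I) => // t s' lt hy [fr fa] [h1 h2 h3].
have {}lt : t < n := lt; pose w := Ordinal lt.
have {}hi : reg s' rx = i by rewrite fr.
have eA : arr s' rA (reg s' rx) (reg s' ry) = edges s i w by rewrite hi hy fa.
have ltS (j : 'I_n) : j < t.+1 -> j = w \/ j < t.
  by rewrite ltnS leq_eqVlt => /orP[/eqP E|]; [left; apply: val_inj|right].
rewrite /I /marked [exec _ _]/= eA hy; case Eiw: (edges s i w); last first.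
  by split=> // j /ltS[->|/h2//]; rewrite Eiw.
split=> j.
- by move/h1; rewrite arr_seta_diag; case: ifP.
- by move/ltS=> [->|/h2 H /H]; rewrite arr_seta_diag ?eqxx //; case: ifP.
- rewrite arr_seta_diag; case: eqP => [jt _|_ /h3 //].
  by have <- : w = j; [apply: val_inj|apply: PS Pi Eiw].
Qed.

Lemma search_roundP s (P : pred 'I_n) :
  (forall j, marked s j -> P j) -> (forall i j, P i -> edges s i j -> P j) ->
  let s' := exec search_round s in
  [/\ forall j, marked s j -> marked s' j,
      forall i j, marked s i -> edges s i j -> marked s' j
    & forall j, marked s' j -> P j].
Proof.
move=> P0 PS.
pose I t s' := [/\ forall j, marked s j -> marked s' j,
  forall i j : 'I_n, i < t -> marked s i -> edges s i j -> marked s' j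
  & forall j, marked s' j -> P j].
suff [h1 h2 h3] : I n (exec search_round s) by split=> // i j; apply: h2.
apply: (@exec_for_ind n k I) => // t s' lt hx [fr fa] [h1 h2 h3].
have {}lt : t < n := lt; pose w := Ordinal lt.
have eE : edges s' = edges s by rewrite /edges fa.
have ltS (j : 'I_n) : j < t.+1 -> j = w \/ j < t.
  by rewrite ltnS leq_eqVlt => /orP[/eqP E|]; [left; apply: val_inj|right].
have hw : reg s' rx = w by [].
set c := IfArr _ _ _ _ _ in fr fa *.
suff : I t.+1 (exec c s') by [].
rewrite /c /I [exec _ _]/= hw -/(marked s' w); case mw: (marked s' w); last first.
  split=> // i j /ltS[->|/h2 H]; last exact: H.
  by move/h1; rewrite mw.
have [|g1 g2 g3] := @search_rowP s' P w hw (h3 _ mw) h3; first by rewrite eE.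
split=> // [j /h1/g1 //|i j /ltS[-> _ Ewj|lt' mi Eij]]; first by apply: g2; rewrite eE.
by apply/g1/(h2 i).
Qed.

(** After t rounds the end of every walk with at most t edges from u is marked. A simple path has
    fewer than n edges, so n rounds reach the whole component. *)
Lemma searchP s (u : 'I_n) : reg s ra = u ->
  forall j, marked (exec search s) j = connect (edges s) u j.
Proof.
move=> hu j; pose s1 := exec (For rx (SetArr rR rx rx false)) s.
have E1 : s1 = exec (For rx (SetArr rR rx rx false)) s by [].
have z1 (i : 'I_n) : marked s1 i = false.
  pose I t s' := forall i : 'I_n, i < t -> marked s' i = false.
  suff : I n (exec (For rx (SetArr rR rx rx false)) s) by rewrite -E1 => H; apply: H.
  apply: (@exec_for_ind n k I rx (SetArr rR rx rx false) s) => // t s' _ hx _ h i'.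
  rewrite ltnS leq_eqVlt /marked [exec _ _]/= hx => lt.
  rewrite -[LHS]/(arr (seta s' rR t t false) rR i' i') arr_seta_diag.
  by case: eqP lt => //= _; apply: h.
have u1 : reg s1 ra = u by rewrite E1 exec_frame.
have e1 : edges s1 = edges s by rewrite E1 /edges exec_arr_frame.
pose s2 := seta s1 rR (reg s1 ra) (reg s1 ra) true.
have e2 : edges s2 = edges s by rewrite -e1.
have m2 (i : 'I_n) : marked s2 i = (i == u).
  by rewrite /marked /s2 u1 arr_seta_diag -/(marked s1 i) z1 -val_eqE; case: eqP.
rewrite -[exec search s]/(exec (For rr search_round) s2).
pose I t s' := (forall p, path (edges s) u p -> size p <= t -> marked s' (last u p)) /\
  (forall i, marked s' i -> connect (edges s) u i).
have [h1 h2] : I n (exec (For rr search_round) s2).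
  apply: (@exec_for_ind n k I rr search_round s2) => //.
    split=> [[|//] _ _|i]; first by rewrite -[marked _ _]/(marked s2 u) m2 /=.
    by rewrite -[marked _ _]/(marked s2 i) m2 => /eqP->.
  move=> t s' _ _ [_ fa] [h1 h2].
  have e' : edges s' = edges s by rewrite -e2 /edges fa.
  suff : I t.+1 (exec search_round s') by [].
  have [//||g1 g2 g3] := @search_roundP s' (connect (edges s) u).
    by move=> i i' ci; rewrite e' => /connect1; apply: connect_trans.
  split=> //; elim/last_ind => [_ _|p z _]; first by apply/g1/(h1 [::]).
  rewrite rcons_path size_rcons last_rcons ltnS => /andP[pp ez] sp.
  by apply: g2 (h1 p pp sp) _; rewrite e'.
apply/idP/idP => [/h2//|/connectP[p0 pp0 ->]].
case/shortenP: pp0 => p pp up _; apply: h1 => //.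
have := max_card (mem (u :: p)); rewrite (card_uniqP up) card_ord /=; exact: ltnW.
Qed.

Definition not_bridge (u v : 'I_n) E := E u v -> connect (del_edge E u v) u v.

Lemma bridge_pairP s (u v : 'I_n) : reg s ra = u -> reg s rb = v ->
  pass (not_bridge u v) (edges s) (edges (exec bridge_pair s)).
Proof.
move=> hu hv se ie; pose s1 := exec (set_sym ra rb false) s; pose s2 := exec search s1.
have -> : exec bridge_pair s = if arr s rA (reg s ra) (reg s rb)
  then if arr s2 rR (reg s2 rb) (reg s2 rb) then exec (set_sym ra rb true) s2 else s2
  else s by [].
rewrite hu hv -[arr s _ _ _]/(edges s u v).
case Euv: (edges s u v); last first.
  by split=> //; split=> // _; rewrite /not_bridge Euv.
have e1 : edges s1 = del_edge (edges s) u v by apply: edges_del.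
have e2 : edges s2 = del_edge (edges s) u v by rewrite -e1 /edges exec_arr_frame.
have u2 : reg s2 ra = u by rewrite exec_frame // exec_frame.
have v2 : reg s2 rb = v by rewrite exec_frame // exec_frame.
have m2 : arr s2 rR v v = connect (del_edge (edges s) u v) u v.
  by rewrite -e1 -searchP ?exec_frame.
rewrite v2 m2; case: ifP => [c|/negbT nc].
  rewrite (edges_set_sym _ u2 v2) e2.
  suff -> : (fun i j => if same_edge u v i j then true else del_edge (edges s) u v i j) = edges s.
    by split=> //; split=> // _ _.
  apply: functional_extensionality => i; apply: functional_extensionality => j.
  rewrite /del_edge /=; case E: (same_edge u v i j); last by rewrite andbT.
  by case/orP: E => /andP[/eqP-> /eqP->]; rewrite ?(se v).
rewrite e2; split; [exact: del_edge_sub|exact: del_edge_sym|exact: bridge_rule|].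
split=> [E|/(_ Euv) c]; last by rewrite c in nc.
by move: Euv; rewrite -E /del_edge /= /same_edge !eqxx andbF.
Qed.

Definition reduced E := (forall u v : 'I_n, u < v -> few_common u v E) /\
  (forall u v, not_bridge u v E).

Lemma reduce_round s : reg s rt = 2 * k + 2 ->
  pass reduced (edges s) (edges (exec (Sq twin_pass bridge_pass) s)).
Proof.
move=> ht.
(* Loop variables are plain numbers, so the conditions quantify over the proofs that make them
   vertices; these proofs are unique. *)
pose P1 i j E := forall (hi : i < n) (hj : j < n), i < j -> few_common (Ordinal hi) (Ordinal hj) E.
pose P2 i j E := forall (hi : i < n) (hj : j < n), not_bridge (Ordinal hi) (Ordinal hj) E.
have p1 : pass (fun E => forall i, i < n -> forall j, j < n -> P1 i j E)
    (edges s) (edges (exec twin_pass s)).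
  apply: (@pass_for _ ra) => // i s1 hi hu [fr _].
  apply: (@pass_for _ rb) => // j s2 hj hv [fr' _].
  have {}hu : reg s2 ra = i by rewrite fr'.
  have {}ht : reg s2 rt = 2 * k + 2 by rewrite fr' // fr.
  rewrite [exec _ _]/= hu hv; case: ifP => [lt|/negbT nlt]; last first.
    by apply: pass_skip => a b ab; rewrite ab in nlt.
  have {}hi : i < n := hi; have {}hj : j < n := hj.
  have nij : Ordinal hi != Ordinal hj by rewrite -val_eqE /= ltn_eqF.
  apply: pass_equiv (@twin_pairP s2 (Ordinal hi) (Ordinal hj) hu hv nij ht).
  split=> [h a b _|h]; last exact: h.
  by rewrite (bool_irrelevance a hi) (bool_irrelevance b hj).
have p2 s0 : pass (fun E => forall i, i < n -> forall j, j < n -> P2 i j E)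
    (edges s0) (edges (exec bridge_pass s0)).
  apply: (@pass_for _ ra) => // i s1 hi hu _.
  apply: (@pass_for _ rb) => // j s2 hj hv [fr' _].
  have {}hu : reg s2 ra = i by rewrite fr'.
  have {}hi : i < n := hi; have {}hj : j < n := hj.
  apply: pass_equiv (@bridge_pairP s2 (Ordinal hi) (Ordinal hj) hu hv).
  split=> [h a b|h]; last exact: h.
  by rewrite (bool_irrelevance a hi) (bool_irrelevance b hj).
apply: pass_equiv (pass_seq p1 (p2 (exec twin_pass s))).
split=> [[h1 h2]|[h1 h2]]; split.
- move=> [i hi] [j hj] lt; exact: (h1 i hi j hj hi hj).
- move=> [i hi] [j hj]; exact: (h2 i hi j hj hi hj).
- by move=> i _ j _ hi hj lt; apply: h1.
- by move=> i _ j _ hi hj; apply: h2.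
Qed.

Definition edge_count E := #|[set p : 'I_n * 'I_n | E p.1 p.2]|.

(** After t rounds the graph is reduced, and then further rounds leave it alone, or at least t of
    the at most n * n ordered adjacent pairs are gone. In the second case no edge is left at the
    end, and the empty graph is reduced. *)
Lemma reduceP s : reg s rt = 2 * k + 2 -> symmetric (edges s) -> irreflexive (edges s) ->
  let E := edges (exec reduce s) in
  [/\ subrel E (edges s), symmetric E, solvable E k -> solvable (edges s) k & reduced E].
Proof.
move=> ht se ie.
pose I t s' := let E := edges s' in [/\ subrel E (edges s), symmetric E,
  solvable E k -> solvable (edges s) k & reduced E \/ edge_count E + t <= n * n].
suff [b1 s1 v1 [r1|c0]] : I (n * n) (exec reduce s).
- by split.
- split=> //; have E0 i j : edges (exec reduce s) i j = false.
    apply/negP => Eij.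
    have : 0 < edge_count (edges (exec reduce s)) by apply/card_gt0P; exists (i, j); rewrite inE.
    by lia.
  split=> u v; last by rewrite /not_bridge E0.
  by rewrite /few_common (_ : [set w | _] = set0) ?cards0 //; apply/setP => w; rewrite !inE !E0.
apply: (@exec_for_ind n k (fun i => I (i * n)) rp) => //.
  split=> //; right; rewrite addn0 /edge_count; apply: leq_trans (max_card _) _.
  by rewrite card_prod card_ord.
move=> i s1 _ _ [fr1 _] I1.
suff : I (i * n + n) (exec (For rq (Sq twin_pass bridge_pass)) s1) by rewrite mulSn addnC.
apply: (@exec_for_ind n k (fun j => I (i * n + j)) rq) => //; first by rewrite addn0.
move=> j s2 _ _ [fr2 _] [b1 sy1 v1 r1].
have t2 : reg s2 rt = 2 * k + 2 by rewrite fr2 // fr1.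
suff : I (i * n + j.+1) (exec (Sq twin_pass bridge_pass) s2) by [].
have [b2 sy2 v2 e2] := reduce_round t2 sy1 (sub_irreflexive b1 ie).
split=> //; [by move=> x y /b2/b1|by move/v2/v1|].
case: r1 => [r1|c1]; first by have -> := e2.2 r1; left.
case: (boolP (edge_count (edges (exec (Sq twin_pass bridge_pass) s2)) < edge_count (edges s2))) => lt.
  by right; lia.
left; have E : edges (exec (Sq twin_pass bridge_pass) s2) = edges s2.
  apply: rel_antisym => // x y Exy.
  have sub : [set p | edges (exec (Sq twin_pass bridge_pass) s2) p.1 p.2]
      \subset [set p | edges s2 p.1 p.2] by apply/subsetP => p; rewrite !inE; apply: b2.
  have /setP/(_ (x, y)) : [set p | edges (exec (Sq twin_pass bridge_pass) s2) p.1 p.2]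
      = [set p | edges s2 p.1 p.2] by apply/eqP; rewrite eqEcard sub /= leqNgt.
  by rewrite !inE /= Exy.
by rewrite E; apply/e2.
Qed.

Lemma mark_aliveP s (al := fun i => has (arr s rA i) (iota 0 n)) (s' := exec mark_alive s) :
  (forall i, i < n -> arr s' rR i i = al i) /\ reg s' rm = count al (iota 0 n).
Proof.
pose I t s1 := (forall i, i < t -> arr s1 rR i i = al i) /\ reg s1 rm = count al (iota 0 t).
suff : I n s' by [].
pose row := For ry (IfArr rA rx ry (SetArr rR rx rx true) Skip).
pose body := Sq (SetArr rR rx rx false) (Sq row (IfArr rR rx rx (Inc rm) Skip)).
rewrite /s' -[exec mark_alive s]/(exec (For rx body) (setr s rm 0)).
apply: (@exec_for_ind n k I rx body (setr s rm 0)) => // i s1 hi hx [_ fa] [r1 m1].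
have {}fa : arr s1 rA = arr s rA by rewrite fa.
pose s2 := seta s1 rR i i false.
have r2 : forall j, arr (exec row s2) rR j j =
    if j == i then al i else arr s1 rR j j.
  pose J t s3 := forall j, arr s3 rR j j =
    if j == i then has (arr s rA i) (iota 0 t) else arr s1 rR j j.
  suff : J n (exec row s2) by [].
  apply: (@exec_for_ind n k J ry (IfArr rA rx ry (SetArr rR rx rx true) Skip) s2) => //.
    by move=> j; rewrite -[LHS]/(arr s2 rR j j) arr_seta_diag.
  move=> t s3 _ hy [fr fa3] r3.
  have x3 : reg s3 rx = i by rewrite fr.
  have a3 : arr s3 rA = arr s rA by rewrite fa3.
  suff : J t.+1 (exec (IfArr rA rx ry (SetArr rR rx rx true) Skip) s3) by [].
  move=> j; rewrite [exec _ _]/= x3 hy a3 -[t.+1]addn1 iotaD has_cat /= orbF.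
  case: (arr s rA i t); last by rewrite orbF r3.
  by rewrite orbT arr_seta_diag r3; case: (j == i).
have m2 : reg (exec row s2) rm = count al (iota 0 i) by rewrite exec_frame.
have x2 : reg (exec row s2) rx = i by rewrite exec_frame.
have cS : count al (iota 0 i.+1) = count al (iota 0 i) + al i.
  by rewrite -[i.+1]addn1 iotaD count_cat /= addn0.
suff : I i.+1 (exec (IfArr rR rx rx (Inc rm) Skip) (exec row s2)).
  by rewrite /s2 -hx.
have r4 : forall j, j < i.+1 -> arr (exec row s2) rR j j = al j.
  by move=> j; rewrite r2 ltnS leq_eqVlt => /orP[/eqP->|lt]; [rewrite eqxx|rewrite ltn_eqF // r1].
rewrite [exec (IfArr _ _ _ _ _) _]/= x2 r4 // /I cS; case: (al i); split=> //.
- by rewrite /= /upd /= -/(exec row s2) m2 addn1.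
- by rewrite m2 addn0.
Qed.

Lemma exec_for_add x c d r s : ~~ assigned x c -> r != x ->
  (forall s', reg (exec c s') r = reg s' r + d) ->
  reg (exec (For x c) s) r = reg s r + bound x * d.
Proof.
move=> na nr H.
apply: (@exec_for_ind n k (fun i s' => reg s' r = reg s r + i * d) x c s) => //=.
  by rewrite /upd (negPf nr) addn0.
by move=> i s' _ _ _ E; rewrite /upd (negPf nr) H E mulSn; lia.
Qed.

Lemma cubicP s : reg (exec cubic s) rc = 18 * k ^ 3.
Proof.
pose c := For 8 (For 9 (For 10 (iter 18 (Sq (Inc rc)) Skip))).
rewrite -[exec cubic s]/(exec c (setr s rc 0)).
rewrite (@exec_for_add 8 _ (k * (k * 18))) //.
  by rewrite -[bound 8]/k /= /upd /= !expnS expn0; lia.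
move=> s1; rewrite (@exec_for_add 9 _ (k * 18)) // => s2.
rewrite (@exec_for_add 10 _ 18) // => s3.
by rewrite /= /upd /=; lia.
Qed.

Lemma emitsP w s : out (exec (emits w) s) = out s ++ w.
Proof. by elim: w s => [|b w IH] s /=; rewrite ?cats0 // IH /= cat_rcons. Qed.

Lemma flatten_filter (T : Type) (al : pred nat) (g : nat -> seq T) r :
  flatten [seq if al i then g i else [::] | i <- r] = flatten [seq g i | i <- r & al i].
Proof. by elim: r => //= i r ->; case: (al i). Qed.

Lemma flatten_const (T : Type) (b : T) (r : seq nat) :
  flatten [seq [:: b] | i <- r] = nseq (size r) b.
Proof. by elim: r => //= i r ->. Qed.

Lemma emit_graphP s al (r := [seq i <- iota 0 n | al i]) :
  (forall i, i < n -> arr s rR i i = al i) -> out s = [::] ->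
  out (exec emit_graph s) = nseq k true ++ false :: nseq (size r) true ++ false ::
    [seq arr s rA i j | i <- r, j <- r].
Proof.
move=> hal o0.
pose s1 := exec (For 8 (Emit true)) s; pose s2 := emit s1 false.
pose s3 := exec (For rx (IfArr rR rx rx (Emit true) Skip)) s2; pose s4 := emit s3 false.
pose row := For ry (IfArr rR ry ry (IfArr rA rx ry (Emit true) (Emit false)) Skip).
rewrite -[exec emit_graph s]/(exec (For rx (IfArr rR rx rx row Skip)) s4).
have a2 a : arr s2 a = arr s a by rewrite /s2 /= exec_arr_frame.
have a4 a : arr s4 a = arr s a by rewrite /s4 /= exec_arr_frame // a2.
have bx : bound rx = n by []. have b8 : bound 8 = k by [].
rewrite (@exec_for_out n k rx _ _ (fun i => if al i then [seq arr s rA i j | j <- r] else [::])) //.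
  have -> : out s4 = nseq k true ++ false :: nseq (size r) true ++ [:: false].
    rewrite /s4 /= (@exec_for_out n k rx _ _ (fun i => if al i then [:: true] else [::])) //.
      rewrite flatten_filter flatten_const bx /= (@exec_for_out n k 8 _ _ (fun=> [:: true])) //.
        by rewrite flatten_const size_iota b8 o0 -!cats1 -!catA.
      by move=> i s' _ _ _; rewrite /= cats1.
    move=> i s' hi hx [_ fa]; rewrite /= hx fa // a2 hal //.
    by case: (al i); rewrite ?cats0 /= ?cats1.
  by rewrite flatten_filter bx -!catA /= -catA.
move=> i s' hi hx [_ fa]; rewrite [exec _ _]/= hx fa // a4 hal //.
case ai: (al i); last by rewrite cats0.
rewrite -[iter _ _ _]/(exec row s').
rewrite (@exec_for_out n k ry _ _ (fun j => if al j then [:: arr s rA i j] else [::])) //.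
  by rewrite flatten_filter flatten_map1.
move=> j s'' hj hy [fr' fa']; rewrite /= hy fr' // hx !fa' // !fa // !a4 hal //.
by case: (al j); rewrite ?cats0 //; case: (arr s rA i j); rewrite /= cats1.
Qed.

End Kernel.

(** * The matrix encoding, the negative instance and the final assembly *)

Lemma nth_square (T : Type) (x0 : bool) (f : T -> T -> bool) (t0 : T) (s t : seq T) i j :
  i < size s -> j < size t ->
  nth x0 [seq f x y | x <- s, y <- t] (i * size t + j) = f (nth t0 s i) (nth t0 t j).
Proof.
elim: s i => //= x s IH [|i] hi hj; rewrite nth_cat size_map.
  by rewrite mul0n add0n hj (nth_map t0).
by rewrite mulSn -addnA ltnNge leq_addr /= addKn IH.
Qed.

Lemma allpairs_map (S T : Type) (g : S -> T) (f : T -> T -> bool) (s : seq S) :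
  [seq f (g x) (g y) | x <- s, y <- s] = [seq f x y | x <- map g s, y <- map g s].
Proof.
by rewrite -map_comp; congr flatten; apply: eq_map => x /=; rewrite -map_comp.
Qed.

Definition triangle_adj : rel 'I_3 := fun x y => x != y.

Lemma triangle_sym : symmetric triangle_adj.
Proof. by move=> x y; rewrite /triangle_adj eq_sym. Qed.

Lemma triangle_irrefl : irreflexive triangle_adj.
Proof. by move=> x; rewrite /triangle_adj eqxx. Qed.

Definition triangle := SGraph triangle_sym triangle_irrefl.

Lemma encode_triangle : encode triangle 0 = no_instance.
Proof.
rewrite /encode card_ord /no_instance.
have -> : [seq adj x y | x <- enum triangle, y <- enum triangle] =
    [seq i != j | i <- map val (enum 'I_3), j <- map val (enum 'I_3)].
  exact: (allpairs_map val (fun i j => i != j) (enum 'I_3)).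
by rewrite val_enum_ord.
Qed.

Lemma triangle_no : ~ forest_identification triangle 0.
Proof.
case=> j [H [j0 id fH]]; move: j0; rewrite leqn0 => /eqP j0; subst j.
inversion id; subst H; apply: fH.
by exists [:: @Ordinal 3 0 isT; @Ordinal 3 1 isT; @Ordinal 3 2 isT].
Qed.

Theorem theorem3p8 :
  exists f : nat -> nat,
    big_O f (fun k => k ^ 3) /\ admits_kernel forest_identification f.
Proof.
(* The summand 3 accounts for the triangle; for k >= 1 it is absorbed, giving the constant 21. *)
exists (fun k => 18 * k ^ 3 + 3); split.
  by exists 21, 1 => k k1; have : 0 < k ^ 3 by [rewrite expn_gt0 k1]; lia.
have [M [p [pp HM]]] := cmd_machine wf_kernel.
(* The output parameter is k or 0, so the identity bounds it. *)
exists M, p, id; split=> // G k; pose n := #|G|.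
pose w := [seq adj x y | x <- enum G, y <- enum G].
have {}HM := HM n k w.
pose s1 := exec n k read_matrix (init_state w).
pose s2 := exec n k set_threshold s1.
pose s3 := exec n k reduce s2.
pose s4 := exec n k mark_alive s3.
pose s5 := exec n k cubic s4.
have sE : exec n k kernel (init_state w) = if reg s5 rc < reg s5 rm
  then exec n k (emits no_instance) s5 else exec n k emit_graph s5 by [].
have sw : size w = n * n by rewrite size_allpairs -cardE.
have [i1 e1] := @read_matrixP n k (init_state w) w erefl sw.
have i0 : inp (exec n k kernel (init_state w)) = [::].
  rewrite -[exec n k kernel _]/(exec n k (Sq set_threshold (Sq reduce (Sq mark_alive
    (Sq cubic (IfLt rc rm (emits no_instance) emit_graph))))) s1).
  exact: exec_inp_nil.
have {}HM := HM i0; rewrite sE in HM.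
(* The input graph with its vertices numbered as in the encoded matrix. *)
pose E0 : rel 'I_n := fun i j => adj (enum_val i) (enum_val j).
have E2 : edges s2 = E0 :> rel 'I_n.
  apply: functional_extensionality => i; apply: functional_extensionality => j.
  rewrite /edges /s2 exec_arr_frame // -/(edges s1 i j) e1 /w.
  have -> : (i * n + j) = i * size (enum G) + j by rewrite -cardE.
  rewrite (nth_square _ _ (enum_val i)) -?cardE //.
  by rewrite /E0 -!enum_val_nth.
have t2 : reg s2 rt = 2 * k + 2 by apply: set_thresholdP; rewrite exec_frame.
have se : symmetric (edges s2 : rel 'I_n) by rewrite E2 => i j; rewrite /E0 adj_sym.
have ie : irreflexive (edges s2 : rel 'I_n) by rewrite E2 => i; rewrite /E0 adj_irrefl.
have [b3 sy3 v3 [few nb]] := reduceP t2 se ie.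
set E := edges (exec n k reduce s2) in b3 sy3 v3 few nb.
have ie3 : irreflexive E := sub_irreflexive b3 ie.
have solE : forest_identification G k <-> solvable E k.
  rewrite forest_identification_solvable (solvable_bij _ k (@enum_rankK G) (@enum_valK G)).
  (* Deleting edges preserves solutions, and the converse is the guarantee of [reduceP]. *)
  rewrite -[X in solvable X k]/E0 -E2; split=> //; exact: solvable_sub.
have [al4 m4] := mark_aliveP n k s3.
set al := fun i => _ in al4 m4.
have a5 a : arr s5 a = arr s4 a by rewrite /s5 exec_arr_frame.
have m5 : reg s5 rm = count al (iota 0 n) by rewrite /s5 exec_frame.
have c5 : reg s5 rc = 18 * k ^ 3 by apply: cubicP.
have alE (i : 'I_n) : al i = [exists j, E i j].
  apply/hasP/existsP => [[j]|[j Eij]]; last by exists (val j); rewrite ?mem_iota /=.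
  by rewrite mem_iota => /= hj Eij; exists (Ordinal hj).
pose r := [seq i <- enum 'I_n | al (val i)].
have rv : map val r = [seq i <- iota 0 n | al i].
  by rewrite -val_enum_ord filter_map.
have cr : count al (iota 0 n) = size r by rewrite -size_filter -rv size_map.
have crE : size r = #|[set x | [exists y, E x y]]|.
  rewrite cardE; apply: perm_size; apply: uniq_perm; first by apply: filter_uniq; apply: enum_uniq.
    exact: enum_uniq.
  by move=> i; rewrite mem_filter [in RHS]mem_enum inE alE mem_enum inE andbT.
have o5 : out s5 = [::] by do 5!(apply: exec_silent; first by []).
case: ifP HM => [lt HM|/negbT ge HM].
  exists triangle, 0; split=> //; last by rewrite card_ord; lia.
    by move: HM; rewrite encode_triangle emitsP o5.
  split=> [/solE sol|/triangle_no //].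
  suff : size r <= 18 * k ^ 3 by lia.
  (* The program treats only pairs a < b; symmetry covers the others. *)
  rewrite crE; apply: reduced_card sol => // a b nab.
  case: (ltngtP a b) => [lab|lba|/val_inj E']; [exact: few| |by rewrite E' eqxx in nab].
  rewrite (_ : [set x | _] = [set x | E b x && E a x]); first exact: few.
  by apply/setP => x; rewrite !inE andbC.
(* [h] lists the non-isolated vertices in increasing order, the order in which the program writes
   their rows. *)
pose h := tnth (in_tuple r).
have hinj : injective h by apply/tuple_uniqP; apply: filter_uniq; apply: enum_uniq.
pose A : rel 'I_(size r) := [rel x y | E (h x) (h y)].
have sA : symmetric A by move=> x y; rewrite /A /= sy3.
have iA : irreflexive A by move=> x; rewrite /A /= ie3.
have hr : map h (enum 'I_(size r)) = r by apply: map_tnth_enum.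
exists (SGraph sA iA), k; split=> //.
- move: HM; rewrite (emit_graphP k (al := al)) //; last by move=> i hi; rewrite a5 al4.
  suff -> : encode (SGraph sA iA) k = nseq k true ++ false ::
      nseq (size [seq i <- iota 0 n | al i]) true ++ false ::
      [seq arr s5 rA i j | i <- [seq i <- iota 0 n | al i], j <- [seq i <- iota 0 n | al i]] by [].
  have aE : arr s5 rA = arr s3 rA by rewrite a5 exec_arr_frame.
  have hv : map val r = map (val \o h) (enum 'I_(size r)) by rewrite map_comp hr.
  rewrite /encode card_ord -rv size_map aE hv.
  by rewrite -(allpairs_map (val \o h) (arr s3 rA) (enum 'I_(size r))).
- rewrite solE forest_identification_solvable; apply: solvable_support => // x y Exy.
  have : x \in map h (enum 'I_(size r)).
    by rewrite hr mem_filter mem_enum alE andbT; apply/existsP; exists y.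
  by case/mapP=> z _ ->; apply: codom_f.
- by rewrite card_ord; lia.
Qed.
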